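(* Let $T$ be a rising tree, and let $M_T(X)=\#\{q\in\mathbb Q\cap[0,1] : m(T)_q\le X\}$. Then, as $X\to\infty$, $$M_T(X)=\frac{6\,\mathrm{Area}(\mathcal W_T)}{\pi^2}(\log X)^2+O\left(\log X\,\log\log X\right).$$
   Context: All fractions $k/n$ are in lowest terms with $n\ge1$. Two fractions $a/b<c/d$ in $[0,1]$ are Farey neighbours if $bc-ad=1$; their mediant is $(a+c)/(b+d)$. Each $q\in\mathbb Q\cap(0,1)$ is the mediant of a unique pair of Farey neighbours in $[0,1]$, denoted $q_0<q_0'$. A real Markov tree $T$ with base triple $(s_0,u_0,t_0)\in\mathbb R^3$ is a rooted planar trivalent tree (the root has degree 1, all other vertices degree 3) whose complementary regions carry real labels; the root edge has the region $s_0$ on its left, $t_0$ on its right, and leads to the region $u_0$; and for every non-root edge, with regions $s,t$ on its two sides and $r,u$ at its two ends, $r+u=st$. The regions are Farey-indexed by $\mathbb Q\cap[0,1]$, writing $m_q=m(T)_q$: $m_0=s_0$, $m_{1/2}=u_0$, $m_1=t_0$, and for each $q\in\mathbb Q\cap(0,1)$, if $p$ is the mediant of $q_0,q$ and $p'$ the mediant of $q,q_0'$, then $m_p=m_{q_0}m_q-m_{q_0'}$ and $m_{p'}=m_qm_{q_0'}-m_{q_0}$. The non-root vertices correspond to $q\in\mathbb Q\cap(0,1)$: the regions $q_0,q,q_0'$ meet at vertex $q$. Let $e_q$ be the edge at vertex $q$ on the side of the root. It is (positively) directed away from the root if $2m_q-m_{q_0}m_{q_0'}>0$, towards the root if this is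 negative, and undirected if it is $0$. $T$ is a rising tree if all labels are $>2$ and all edges are positively directed away from the root except for those on a finite (possibly empty) simple path starting at the root. The encoding function $\Phi_T:[0,1]\to\mathbb R_{\ge0}$ is the unique continuous function with $m_{k/n}=2\cosh(n\Phi_T(k/n))$ for all $k/n\in\mathbb Q\cap[0,1]$ (it exists for rising trees). The wedge $\mathcal W_T$ is the region in the plane, in polar coordinates, $\{(r\cos\theta,r\sin\theta): 0\le\theta\le\pi/4,\ 0\le r\le f(\theta)\}$, where $f(\theta)=\dfrac1{\cos(\theta)\,\Phi_T(\tan\theta)}$. *)

(* Defs.v *)
From HB Require Import structures.
From mathcomp Require Import all_boot all_order all_algebra.
From mathcomp Require Import finmap all_classical all_reals all_analysis.

Set Implicit Arguments.
Unset Strict Implicit.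
Unset Printing Implicit Defensive.

Import Order.TTheory GRing.Theory Num.Theory.
Import numFieldNormedType.Exports.
Local Open Scope classical_set_scope.
Local Open Scope ring_scope.

(* Numerators and denominators are read off rat, which is always in lowest
   terms with positive denominator. *)
Definition farey_neighbours (x y : rat) : Prop :=
  [/\ 0 <= x, x < y, y <= 1 & denq x * numq y - numq x * denq y = 1].

Definition mediant (x y : rat) : rat :=
  (numq x + numq y)%:Q / (denq x + denq y)%:Q.

(* x, y are the q_0 < q_0' of q; for q in Q \cap (0,1) this pair is unique. *)
Definition farey_parents (q x y : rat) : Prop :=
  farey_neighbours x y /\ q = mediant x y.

(* Only the labels at rationals of [0, 1] are meaningful.  The two recursive
   fields are the relation r + u = st at the two edges leaving vertex q away
   from the root, whose side regions are q_0, q, resp. q, q_0'. *)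
Record markov_tree (R : realType) := MarkovTree {
  base_s : R;
  base_u : R;
  base_t : R;
  label :> rat -> R;
  label_0 : label 0 = base_s;
  label_half : label (1 / 2) = base_u;
  label_1 : label 1 = base_t;
  label_left : forall q x y, 0 < q < 1 -> farey_parents q x y ->
    label (mediant x q) = label x * label q - label y;
  label_right : forall q x y, 0 < q < 1 -> farey_parents q x y ->
    label (mediant q y) = label q * label y - label x }.

(* Non-root vertices, and the edges e_q leading to them from the root side,
   are both represented by the rational q in (0,1). *)
Definition vertex_child (q p : rat) : Prop :=
  exists x y, farey_parents q x y /\ (p = mediant x q \/ p = mediant q y).

Definition positively_directed (R : realType) (T : markov_tree R) (q : rat) :
    Prop :=
  forall x y, farey_parents q x y -> 0 < 2 * T q - T x * T y.

(* The list of edges of a finite simple path starting at the root: such a path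
   never turns back, so it starts with e_{1/2} (or is empty) and then always
   moves to a child. *)
Definition root_path (s : seq rat) : Prop :=
  if s is q :: s' then
    q = 1 / 2 /\ path (fun a b => `[< vertex_child a b >]) q s'
  else True.

Definition rising (R : realType) (T : markov_tree R) : Prop :=
  (forall q : rat, 0 <= q <= 1 -> 2 < T q) /\
  exists s : seq rat, root_path s /\
    forall q : rat, 0 < q < 1 -> q \notin s -> positively_directed T q.

Definition cosh (R : realType) (x : R) : R := (expR x + expR (- x)) / 2.

Definition is_encoding (R : realType) (T : markov_tree R) (Phi : R -> R) :
    Prop :=
  [/\ {within `[0, 1], continuous Phi},
      forall x : R, 0 <= x <= 1 -> 0 <= Phi x
    & forall q : rat, 0 <= q <= 1 ->
        T q = 2 * cosh ((denq q)%:~R * Phi (ratr q))].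

(* The properties determine the encoding function on [0,1]; the values chosen
   outside [0,1] are never used. *)
Definition encoding (R : realType) (T : markov_tree R) : R -> R :=
  xget (fun=> 0) (is_encoding T).

Definition wedge (R : realType) (T : markov_tree R) : set (R * R) :=
  [set z | exists theta r : R,
     [/\ 0 <= theta <= pi / 4,
         0 <= r <= (cos theta * encoding T (tan theta))^-1
       & z = (r * cos theta, r * sin theta)]].

Definition area (R : realType) (A : set (R * R)) : R :=
  fine ((@lebesgue_measure R \x @lebesgue_measure R)%E A).

(* fset_set A is empty when A is infinite; for a rising tree the set counted
   here is always finite. *)
Definition label_count (R : realType) (T : markov_tree R) (X : R) : nat :=
  #|` fset_set [set q : rat | 0 <= q <= 1 /\ T q <= X]|.

(* Packaged so that X -> +oo can be used in Landau notations. *)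
Canonical pinfty_filter (R : realType) : filter_on R :=
  FilterType (pinfty_nbhs R) _.

(* Main.v *)
(* If c is the half length of a label, label = 2 cosh c, then at a vertex with
   half lengths a, b, c the conserved Markov polynomial reads
     (z - 2 cosh (a + b)) (z - 2 cosh (a - b)) = D.
   Along positively directed edges the second factor is exponentially large, so
   c = a + b up to an error that is summable along the tree.  Hence
   (n, k) |-> n Phi(k/n) is a Lipschitz radial function and the labels <= X are
   counted by the primitive lattice points of the wedge dilated by arcosh (X/2).
   All lattice points are counted by area with an error linear in the dilation
   factor, and Moebius inversion over the gcd turns this into the count of
   primitive points, at the price of a harmonic sum. *)

Require Import Defs.
From HB Require Import structures.
From mathcomp Require Import all_boot all_order all_algebra.
From mathcomp Require Import finmap all_classical all_reals all_analysis measurable_realfun.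
From mathcomp Require Import zify ring lra.

Set Implicit Arguments.
Unset Strict Implicit.
Unset Printing Implicit Defensive.

Import Order.TTheory GRing.Theory Num.Theory.
Import numFieldNormedType.Exports.
Local Open Scope classical_set_scope.
Local Open Scope ring_scope.

(** * Farey pairs *)

(** The function [encoding] is picked by choice, so an encoding has to be constructed before
    anything can be said about it. The obstacle is to control half length over denominator with no
    limit function at hand, from the labels alone. Lower bounds come first: half lengths grow
    linearly in the denominator, and only this makes the factor sinh large in the defect estimate. A
    defect of order 1 / s^2, for s the denominator of the mediant, is already enough, because its
    effect on slopes telescopes along any descending path. The linear growth also keeps the sector
    bounded, so that finitely many labels lie below X. In the inversion the constant 6 / pi^2 enters
    through partial sums of 1 / j^2, so the Basel sum is needed with a rate of convergence. The
    harmonic sum has about log X terms and is multiplied by a radius of size log X: hence log X log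
    log X. *)

Lemma ltq_cross (x y : rat) : (x < y) = (numq x * denq y < numq y * denq x).
Proof. exact: lt_ratE. Qed.

Lemma leq_cross (x y : rat) : (x <= y) = (numq x * denq y <= numq y * denq x).
Proof. exact: le_ratE. Qed.

(** The determinant of x with the mediant is again 1, which is a Bezout identity for the two sums:
    the mediant needs no cancellation. *)
Lemma farey_mediant (x y : rat) : farey_neighbours x y ->
  denq (mediant x y) = denq x + denq y /\
  numq (mediant x y) = numq x + numq y.
Proof.
case=> _ _ _ bcad.
have dx := denq_gt0 x; have dy := denq_gt0 y.
have cop : coprime `|numq x + numq y| `|denq x + denq y|.
  have /coprimezP : exists uv,
      uv.1 * (numq x + numq y) + uv.2 * (denq x + denq y) = 1.
    by exists (denq x, - numq x); rewrite /=; lia.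
  by rewrite coprimezE.
split.
  rewrite /mediant coprimeq_den//.
  by case: eqP => [|_]; lia.
by rewrite /mediant coprimeq_num// gtr0_sg ?mul1r//; lia.
Qed.

Lemma farey_children (x y : rat) : farey_neighbours x y ->
  farey_neighbours x (mediant x y) /\ farey_neighbours (mediant x y) y.
Proof.
move=> xy; have [dm nm] := farey_mediant xy.
case: xy => x0 lxy y1 bcad.
have dx := denq_gt0 x; have dy := denq_gt0 y.
have xm : x < mediant x y by rewrite ltq_cross dm nm; lia.
have my : mediant x y < y by rewrite ltq_cross dm nm; lia.
split; split => //; rewrite ?dm ?nm; try lia.
- exact: le_trans (ltW my) y1.
- exact: le_trans x0 (ltW xm).
Qed.

Lemma farey01 : farey_neighbours 0 1.
Proof. by []. Qed.

(** In the unimodular basis formed by the two neighbours, q has positive integer coordinates, so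
    each of them is at least 1. *)
Lemma farey_denq_between (x y q : rat) : farey_neighbours x y ->
  x < q -> q < y -> denq x + denq y <= denq q.
Proof.
case=> _ _ _ bcad; rewrite !ltq_cross => xq qy.
have dx := denq_gt0 x; have dy := denq_gt0 y.
have -> : denq q = denq x * (numq y * denq q - numq q * denq y) +
                   denq y * (numq q * denq x - numq x * denq q).
  transitivity (denq q * (denq x * numq y - numq x * denq y)); last by ring.
  by rewrite bcad mulr1.
by apply: lerD; rewrite ler_peMr//; lia.
Qed.

(* Descent along the tree: either the pair (x, y) is reached, or the mediant of
   (u, w) does not separate x and y. *)
Lemma farey_ind (P : rat -> rat -> Prop) : P 0 1 ->
  (forall x y, farey_neighbours x y -> P x y ->
     P x (mediant x y) /\ P (mediant x y) y) ->
  forall x y, farey_neighbours x y -> P x y.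
Proof.
move=> P01 Pstep.
suff main n : forall u w x y, farey_neighbours u w -> P u w ->
    farey_neighbours x y -> u <= x -> y <= w ->
    denq x + denq y - (denq u + denq w) < n%:Z -> P x y.
  move=> x y xy; have [x0 _ y1 _] := xy.
  apply: (main (absz (denq x + denq y)) 0 1 x y farey01 P01 xy x0 y1).
  have := denq_gt0 x; have := denq_gt0 y.
  by change (denq 0) with (1 : int); change (denq 1) with (1 : int); lia.
elim: n => [|n IH] u w x y uw Puw xy ux yw small.
  have [_ lxy _ _] := xy.
  have du := denq_gt0 u; have dw := denq_gt0 w.
  have dx := denq_gt0 x; have dy := denq_gt0 y.
  have [eux|nux] := eqVneq u x.
    have [eyw|nyw] := eqVneq y w; first by rewrite -eux eyw.
    have lyw : y < w by rewrite lt_neqAle nyw.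
    have luy : u < y by rewrite eux.
    by have := farey_denq_between uw luy lyw; lia.
  have lux : u < x by rewrite lt_neqAle nux.
  by have := farey_denq_between uw lux (lt_le_trans lxy yw); lia.
have [um mw] := farey_children uw.
have [dm _] := farey_mediant uw.
have [Pum Pmw] := Pstep _ _ uw Puw.
have [_ lxy _ _] := xy.
have du := denq_gt0 u; have dw := denq_gt0 w.
have dx := denq_gt0 x; have dy := denq_gt0 y.
have [ym|my] := leP y (mediant u w); first by apply: IH um Pum _ _ _ _ => //; lia.
have [mx|xm] := leP (mediant u w) x; first by apply: IH mw Pmw _ _ _ _ => //; lia.
(* Now the mediant lies strictly between x and y, so its denominator is at least the sum of theirs.
   An endpoint of (x, y) strictly inside (u, w) would have a denominator larger than the mediant's,
   so the two pairs coincide. *)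
have dmxy := farey_denq_between xy xm my.
have [eux|nux] := eqVneq u x.
  have [eyw|nyw] := eqVneq y w; first by rewrite -eux eyw.
  have lyw : y < w by rewrite lt_neqAle nyw.
  by have := farey_denq_between mw my lyw; lia.
have lux : u < x by rewrite lt_neqAle nux.
by have := farey_denq_between um lux xm; lia.
Qed.

(** Stern-Brocot search: the denominator of q bounds that of every pair enclosing it, and each step
    raises the latter, so q must be hit as a mediant. *)
Lemma farey_parentsP (q : rat) : 0 < q < 1 -> exists x y, farey_parents q x y.
Proof.
move=> /andP[q0 q1].
suff main n : forall u w, farey_neighbours u w -> u < q -> q < w ->
    denq q - (denq u + denq w) < n%:Z -> exists x y, farey_parents q x y.
  apply: (main `|denq q|%N 0 1) => //.
  have := denq_gt0 q.
  by change (denq 0) with (1 : int); change (denq 1) with (1 : int); lia.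
elim: n => [|n IH] u w uw uq qw small.
  by have := farey_denq_between uw uq qw; lia.
have [um mw] := farey_children uw.
have [dm _] := farey_mediant uw.
have du := denq_gt0 u; have dw := denq_gt0 w.
have [qm|mq|->] := ltgtP q (mediant u w); last by exists u, w.
- by apply: (IH u (mediant u w)) => //; lia.
- by apply: (IH (mediant u w) w) => //; lia.
Qed.

Lemma mediant_in01 (x y : rat) : farey_neighbours x y -> 0 < mediant x y < 1.
Proof.
move=> xy; have [[x0 xm _ _] [_ my y1 _]] := farey_children xy.
by rewrite (le_lt_trans x0 xm) (lt_le_trans my y1).
Qed.

Lemma farey_in01 (x y : rat) : farey_neighbours x y ->
  (0 <= x <= 1) /\ (0 <= y <= 1).
Proof.
case=> x0 xy y1 _; rewrite x0 y1 (le_trans (ltW xy) y1).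
by rewrite (le_trans x0 (ltW xy)).
Qed.

(** * Hyperbolic functions *)

Definition sinh (R : realType) (x : R) : R := (expR x - expR (- x)) / 2.

Section Hyperbolic.
Context {R : realType}.
Implicit Types a b c t x y m : R.

Lemma sinh_ge_half t : 0 <= t -> t / 2 <= sinh t.
Proof.
move=> t0; rewrite /sinh ler_pM2r ?invr_gt0//.
have := expR_ge1Dx t; have : expR (- t) <= 1 by rewrite -expR0 ler_expR oppr_le0.
lra.
Qed.

(** Used at t = c s with s the denominator of a mediant; it turns the exponential gain into the
    power s^2 that the summation requires. *)
Lemma sinh_ge_sqr t : 0 <= t -> t ^+ 2 / 8 <= sinh t.
Proof.
move=> t0; rewrite /sinh.
have e1 : expR (- t) <= 1 by rewrite -expR0 ler_expR oppr_le0.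
have e2 : (1 + t / 2) ^+ 2 <= expR t.
  rewrite [in leRHS](splitr t) expRD expr2.
  by apply: ler_pM; rewrite ?expR_ge1Dx//; lra.
by lra.
Qed.

(** Tangent line of the convex function [cosh] at a, obtained from those of the two exponentials. *)
Lemma cosh_diff_ge a b : 0 <= a -> a <= b -> (b - a) * sinh a <= cosh b - cosh a.
Proof.
move=> a0 ab; rewrite /cosh /sinh.
have e1 : expR (- b) <= expR (- a) by rewrite ler_expR lerN2.
have e2 : expR a * (1 + (b - a)) <= expR b.
  rewrite -[in leRHS](subrK a b) expRD mulrC ler_pM2r ?expR_gt0//.
  exact: expR_ge1Dx.
have e3 : expR (- a) * (1 + (a - b)) <= expR (- b).
  have {2}-> : - b = - a + (a - b) by ring.
  by rewrite expRD ler_pM2l ?expR_gt0// expR_ge1Dx.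
nra.
Qed.

Lemma cosh_dist_ge a b t : 0 <= t -> t <= a -> t <= b ->
  `|a - b| * sinh t <= `|cosh a - cosh b|.
Proof.
have sinh_le (u v : R) : u <= v -> sinh u <= sinh v.
  move=> uv; rewrite /sinh ler_pM2r ?invr_gt0//.
  by rewrite lerB// ler_expR// lerN2.
move=> t0; wlog ab : a b / a <= b.
  move=> H ta tb; case: (leP a b) => [ab|/ltW ba]; first exact: H.
  by rewrite distrC [leRHS]distrC; exact: H.
move=> ta tb; rewrite distrC [leRHS]distrC.
have a0 := le_trans t0 ta.
have h := cosh_diff_ge a0 ab.
have s0 : 0 <= sinh t by have := sinh_ge_half t0; lra.
have st := sinh_le _ _ ta.
rewrite ger0_norm ?subr_ge0//; apply: (le_trans _ (ler_norm _)).
by apply: le_trans h; rewrite ler_wpM2l// subr_ge0.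
Qed.

Lemma ler_cosh a b : 0 <= a -> 0 <= b -> (cosh a <= cosh b) = (a <= b).
Proof.
have lt_cosh (u v : R) : 0 <= u -> u < v -> cosh u < cosh v.
  move=> u0 uv; rewrite /cosh ltr_pM2r ?invr_gt0//.
  have e1 : expR u * (1 + (v - u)) <= expR v.
    rewrite -[in leRHS](subrK u v) expRD mulrC ler_pM2r ?expR_gt0//.
    exact: expR_ge1Dx.
  have e2 : expR (- u) * (1 + (u - v)) < expR (- v).
    have {2}-> : - v = - u + (u - v) by ring.
    rewrite expRD ltr_pM2l ?expR_gt0// expR_gt1Dx//.
    by rewrite subr_eq0 lt_eqF.
  have e3 : expR (- u) <= expR u by rewrite ler_expR; lra.
  nra.
move=> a0 b0; case: (ltgtP a b) => [ab|ba|->]; rewrite ?lexx//.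
- by rewrite ltW// lt_cosh.
- by apply/negbTE; rewrite -ltNge lt_cosh.
Qed.

Lemma cosh_inj a b : 0 <= a -> 0 <= b -> cosh a = cosh b -> a = b.
Proof.
by move=> a0 b0 e; apply/le_anti; rewrite -(ler_cosh a0 b0) -(ler_cosh b0 a0) e lexx.
Qed.

(** This is arcosh (m / 2): the argument of [ln] is the larger root of z + 1 / z = m. *)
Definition arcosh_half m : R := ln ((m + Num.sqrt (m ^+ 2 - 4)) / 2).

Lemma arcosh_halfP m : 2 <= m ->
  [/\ 0 <= arcosh_half m, 2 * cosh (arcosh_half m) = m,
      ln (m / 2) <= arcosh_half m & arcosh_half m <= ln m].
Proof.
move=> m2; rewrite /arcosh_half; set s := Num.sqrt _.
have d0 : 0 <= m ^+ 2 - 4 by nra.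
have s0 : 0 <= s by exact: sqrtr_ge0.
have s2 : s ^+ 2 = m ^+ 2 - 4 by rewrite sqr_sqrtr.
have sm : s <= m by nra.
split.
- by rewrite ln_ge0//; lra.
- rewrite /cosh expRN lnK ?posrE; last by lra.
  have -> : ((m + s) / 2)^-1 = (m - s) / 2.
    apply: (@mulfI _ ((m + s) / 2)); first by apply/eqP; lra.
    rewrite divff; last by apply/eqP; lra.
    nra.
  by field.
- by rewrite ler_ln ?posrE; lra.
- by rewrite ler_ln ?posrE; lra.
Qed.

(* The level set equation of the Markov polynomial factors as
   (z - 2 cosh (a + b)) (z - 2 cosh (a - b)) = D, and the edge condition bounds
   the second factor from below by 2 sinh a sinh b. *)
Lemma additivity_defect a b c t x y z : 0 < a -> 0 < b -> 0 < t ->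
  t <= c -> t <= a + b ->
  2 * cosh a = x -> 2 * cosh b = y -> 2 * cosh c = z -> 0 < 2 * z - x * y ->
  `|a + b - c| * (4 * sinh a * sinh b * sinh t) <=
    `|x ^+ 2 + y ^+ 2 + z ^+ 2 - x * y * z - 4|.
Proof.
move=> a0 b0 t0 tc tab ex ey ez zxy.
have eaK : expR a * expR (- a) = 1 by rewrite -expRD subrr expR0.
have ebK : expR b * expR (- b) = 1 by rewrite -expRD subrr expR0.
have sa : 0 < sinh a by have := sinh_ge_half (ltW a0); lra.
have sb : 0 < sinh b by have := sinh_ge_half (ltW b0); lra.
have st : 0 < sinh t by have := sinh_ge_half (ltW t0); lra.
have chD : 2 * cosh (a + b) = expR a * expR b + expR (- a) * expR (- b).
  by rewrite /cosh opprD !expRD; field.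
pose w := expR a * expR (- b) + expR (- a) * expR b.
have fact : x ^+ 2 + y ^+ 2 + z ^+ 2 - x * y * z - 4 =
    (z - 2 * cosh (a + b)) * (z - w).
  rewrite chD /w -ex -ey /cosh.
  move: (expR a) (expR (- a)) (expR b) (expR (- b)) eaK ebK => p p' q q' pp qq.
  have -> : (z - (p * q + p' * q')) * (z - (p * q' + p' * q)) =
    z ^+ 2 - z * (p + p') * (q + q') + (p ^+ 2 + p' ^+ 2) * (q * q') +
     (q ^+ 2 + q' ^+ 2) * (p * p') by ring.
  rewrite pp qq.
  have -> : (2 * ((p + p') / 2)) ^+ 2 = p ^+ 2 + p' ^+ 2 + 2 * (p * p') by field.
  have -> : (2 * ((q + q') / 2)) ^+ 2 = q ^+ 2 + q' ^+ 2 + 2 * (q * q') by field.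
  by rewrite pp qq; field.
(* Here w = 2 cosh (a - b) and x y / 2 = cosh (a + b) + cosh (a - b), so z > x y / 2 gives z - w >
   cosh (a + b) - cosh (a - b). *)
have zw : 2 * sinh a * sinh b <= z - w.
  move: zxy; rewrite -ex -ey /w /sinh /cosh; nra.
have zw0 : 0 < z - w by have := mulr_gt0 sa sb; lra.
rewrite fact normrM (gtr0_norm zw0).
have := cosh_dist_ge (ltW t0) tab tc.
have -> : `|z - 2 * cosh (a + b)| = 2 * `|cosh (a + b) - cosh c|.
  by rewrite distrC -ez -mulrBr normrM ger0_norm.
have -> : `|a + b - c| * (4 * sinh a * sinh b * sinh t) =
  2 * (`|a + b - c| * sinh t) * (2 * sinh a * sinh b) by ring.
move: sa sb st zw {zw0 fact chD}; move: `|_ - c| `|cosh _ - _| (normr_ge0 (a + b - c)).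
move: (sinh a) (sinh b) (sinh t) (z - w) => A B C Z d e d0 A0 B0 C0 ABZ dCe.
apply: ler_pM => //; last by rewrite ler_pM2l.
- by rewrite !mulr_ge0// ltW.
- by rewrite !mulr_ge0// ltW.
Qed.

End Hyperbolic.

(** * Half lengths along a rising tree *)

Lemma seq_lower_bound (R : realType) (I : eqType) (s : seq I) (f : I -> R) :
  (forall i, i \in s -> 0 < f i) ->
  exists2 c : R, 0 < c & forall i, i \in s -> c <= f i.
Proof.
elim: s => [|i s IH] f0; first by exists 1.
have [j js|c c0 cf] := IH; first by rewrite f0// inE js orbT.
exists (Num.min c (f i)); first by rewrite lt_min c0 f0// mem_head.
move=> j; rewrite inE => /orP[/eqP ->|/cf cj]; first by rewrite ge_min lexx orbT.
by rewrite ge_min cj.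
Qed.

Lemma seq_upper_bound (R : realType) (I : eqType) (s : seq I) (f : I -> R) :
  exists2 c : R, 0 <= c & forall i, i \in s -> f i <= c.
Proof.
elim: s => [|i s [c c0 cf]]; first by exists 0.
exists (Num.max c (f i)); first by rewrite le_max c0.
move=> j; rewrite inE => /orP[/eqP ->|/cf cj]; first by rewrite le_max lexx orbT.
by rewrite le_max cj.
Qed.

(** Only membership matters: repetitions, fractions above 1 and the value 0 at d = 0 do no harm. *)
Definition unit_rationals (n : nat) : seq rat :=
  [seq (k%:Z)%:Q / (d%:Z)%:Q | d <- iota 0 n.+1, k <- iota 0 n.+1].

Lemma mem_unit_rationals (n : nat) (q : rat) :
  0 <= q <= 1 -> denq q <= n%:Z -> q \in unit_rationals n.
Proof.
move=> /andP[q0 q1] dn; have dq := denq_gt0 q.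
have n0 : 0 <= numq q by rewrite numq_ge0.
have nd : numq q <= denq q by move: q1; rewrite leq_cross mulr1 mul1r.
apply/allpairsPdep; exists `|denq q|%N, `|numq q|%N; split.
- by rewrite mem_iota /=; lia.
- by rewrite mem_iota /=; lia.
- by rewrite !gez0_abs ?divq_num_den// ltW.
Qed.

Section RisingTree.
Context {R : realType} (T : markov_tree R).
Implicit Types x y q : rat.

Definition half_length q : R := arcosh_half (T q).

Definition markov_level x y : R :=
  let z := mediant x y in
  T x ^+ 2 + T y ^+ 2 + T z ^+ 2 - T x * T y * T z - 4.

(** The label recursion is a Vieta involution: it replaces one label by the other root of the Markov
    polynomial, viewed as a quadratic in that label. *)
Lemma markov_level_const x y : farey_neighbours x y ->
  markov_level x y = markov_level 0 1.
Proof.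
move: x y; apply: farey_ind => // x y xy E; have m01 := mediant_in01 xy.
have pm : farey_parents (mediant x y) x y by [].
rewrite -E /markov_level (label_left T m01 pm) (label_right T m01 pm).
by split; ring.
Qed.

Hypothesis hT : rising T.

Let T_gt2 q : 0 <= q <= 1 -> 2 < T q.
Proof. by case: hT => + _; exact. Qed.

Lemma rising_positive : exists N : nat, forall x y, farey_neighbours x y ->
  N%:Z < denq x + denq y -> 0 < 2 * T (mediant x y) - T x * T y.
Proof.
have [_ [s [_ hs]]] := hT.
have [N hN] : exists N : nat, forall q, q \in s -> denq q <= N%:Z.
  elim: s {hs} => [|q s [N hN]]; first by exists 0%N.
  exists (maxn N `|denq q|%N) => p; rewrite inE => /orP[/eqP ->|/hN].
    by have := denq_gt0 q; lia.
  by lia.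
exists N => x y xy big; have [dm _] := farey_mediant xy.
apply: (hs (mediant x y)) => //; first exact: mediant_in01.
by apply/negP => /hN; lia.
Qed.

Lemma half_lengthP q : 0 <= q <= 1 ->
  [/\ 0 <= half_length q, 2 * cosh (half_length q) = T q
    & ln (T q / 2) <= half_length q].
Proof.
by move=> /T_gt2/ltW q2; have [? ? ? _] := arcosh_halfP q2.
Qed.

(* Half the label, rather than the label, is supermultiplicative along
   positively directed edges. *)
Lemma half_length_growth :
  exists2 c : R, 0 < c & forall q, 0 <= q <= 1 -> c * (denq q)%:~R <= half_length q.
Proof.
have [N hN] := rising_positive.
(* Taking [N.+1] puts 0 and 1, which are not mediants, among the base cases even when N is 0. *)
pose s := [seq q <- unit_rationals N.+1 | 0 <= q <= 1].
have mu0 q : 0 <= q <= 1 -> 0 < ln (T q / 2).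
  by move=> /T_gt2 q2; rewrite ln_gt0// ltr_pdivlMr// mul1r.
have [q|c c0 hc] := @seq_lower_bound R _ s (fun q => ln (T q / 2) / (denq q)%:~R).
  rewrite mem_filter => /andP[q01 _]; rewrite divr_gt0 ?mu0//.
  by rewrite ltr0z denq_gt0.
exists c => // q q01; apply: le_trans (_ : ln (T q / 2) <= _); last first.
  by have [] := half_lengthP q01.
have [n] := ubnP `|denq q|%N; elim: n => // n IH in q q01 *; move=> dn.
have dq := denq_gt0 q.
have [small|big] := leP (denq q) N.+1%:Z.
  rewrite -ler_pdivlMr ?ltr0z//; apply: hc.
  by rewrite mem_filter q01 mem_unit_rationals.
have q0 : q != 0 by apply: contraTneq big => ->.
have q1 : q != 1 by apply: contraTneq big => ->.
have [|x [y [xy qm]]] := @farey_parentsP q.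
  by move: q01; rewrite !le_eqVlt (eq_sym 0) (negbTE q0) (negbTE q1).
have [dm _] := farey_mediant xy; rewrite -qm in dm.
have dx := denq_gt0 x; have dy := denq_gt0 y.
have [x01 y01] := farey_in01 xy.
have hx : c * (denq x)%:~R <= ln (T x / 2).
  by apply: IH => //; clear -dx dy dm dn; lia.
have hy : c * (denq y)%:~R <= ln (T y / 2).
  by apply: IH => //; clear -dx dy dm dn; lia.
have pos : 0 < 2 * T q - T x * T y by rewrite qm; apply: hN xy _; clear -big dm; lia.
have Tx := T_gt2 x01; have Ty := T_gt2 y01.
rewrite dm intrD mulrDr; apply: le_trans (lerD hx hy) _.
rewrite -lnM ?posrE; try lra.
by rewrite ler_ln ?posrE; nra.
Qed.

(** Take t = c s in [additivity_defect]: the sinh of the two parents are at least c / 2 and the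
    third is at least (c s)^2 / 8, whence 8 D / c^4. The finitely many pairs whose edge may point
    towards the root are absorbed in the other constant. *)
Lemma half_length_defect : exists2 A : R, 0 <= A & forall x y,
  farey_neighbours x y ->
  `|half_length x + half_length y - half_length (mediant x y)| *
    (denq x + denq y)%:~R ^+ 2 <= A.
Proof.
have [N hN] := rising_positive; have [c c0 hc] := half_length_growth.
pose f (p : rat * rat) := `|half_length p.1 + half_length p.2 -
  half_length (mediant p.1 p.2)| * (denq p.1 + denq p.2)%:~R ^+ 2.
have [A A0 hA] := seq_upper_bound
  [seq (x, y) | x <- unit_rationals N, y <- unit_rationals N] f.
pose D := `|markov_level 0 1|.
have D0 : 0 <= 8 * D / c ^+ 4.
  by apply: divr_ge0; [rewrite mulr_ge0 ?normr_ge0|rewrite exprn_ge0 ?(ltW c0)].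
exists (A + 8 * D / c ^+ 4); first exact: addr_ge0.
move=> x y xy; have [x01 y01] := farey_in01 xy.
have dx := denq_gt0 x; have dy := denq_gt0 y.
have [small|big] := leP (denq x + denq y) N%:Z.
  apply: le_trans (_ : A <= _); last by rewrite lerDl.
  apply: (hA (x, y)); apply/allpairsP; exists (x, y).
  by split => //; apply: mem_unit_rationals => //=; clear -dx dy small; lia.
have [dm _] := farey_mediant xy.
have m01 : 0 <= mediant x y <= 1.
  by have /andP[/ltW -> /ltW ->] := mediant_in01 xy.
have [a0 ea _] := half_lengthP x01; have [b0 eb _] := half_lengthP y01.
have [_ ez _] := half_lengthP m01.
have la := hc _ x01; have lb := hc _ y01; have lz := hc _ m01.
rewrite dm in lz.
have dx1 : 1 <= (denq x)%:~R :> R by rewrite ler1z.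
have dy1 : 1 <= (denq y)%:~R :> R by rewrite ler1z.
have ca : c <= half_length x by apply: le_trans la; rewrite ler_peMr// ltW.
have cb : c <= half_length y by apply: le_trans lb; rewrite ler_peMr// ltW.
have zpos := hN _ _ xy big.
set s := (denq x + denq y)%:~R in lz *.
have s0 : 0 < s by rewrite ltr0z; clear -dx dy; lia.
have cs : c * s <= half_length x + half_length y.
  by rewrite /s intrD mulrDr lerD.
have := additivity_defect (lt_le_trans c0 ca) (lt_le_trans c0 cb)
  (mulr_gt0 c0 s0) lz cs ea eb ez zpos.
rewrite -[X in _ <= `|X| -> _]/(markov_level x y) (markov_level_const xy) -/D.
have sa := sinh_ge_half a0; have sb := sinh_ge_half b0.
have st := sinh_ge_sqr (ltW (mulr_gt0 c0 s0)).
set d := `|_ - _|; have d0 : 0 <= d by exact: normr_ge0.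
move: (sinh (half_length x)) (sinh (half_length y)) (sinh (c * s)) sa sb st => X Y Z sa sb st H.
have c2 : 0 <= c / 2 by rewrite divr_ge0 ?ltW.
have cX : c / 2 <= X by apply: le_trans sa; rewrite ler_pM2r ?invr_gt0.
have cY : c / 2 <= Y by apply: le_trans sb; rewrite ler_pM2r ?invr_gt0.
have h1 := ler_pM c2 c2 cX cY.
have h2 : c ^+ 4 * s ^+ 2 / 8 <= 4 * X * Y * Z.
  have s20 : 0 <= (c * s) ^+ 2 / 8 by rewrite divr_ge0 ?sqr_ge0.
  have h3 := ler_pM (mulr_ge0 c2 c2) s20 h1 st.
  have -> : c ^+ 4 * s ^+ 2 / 8 = 4 * (c / 2 * (c / 2) * ((c * s) ^+ 2 / 8)) by field.
  have -> : 4 * X * Y * Z = 4 * (X * Y * Z) by ring.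
  by rewrite ler_pM2l.
rewrite ler_wpDl// ler_pdivlMr ?exprn_gt0//.
move: H (ler_wpM2l d0 h2); clear; lra.
Qed.

(** Neighbours are 1 / (product of denominators) apart, so this determinant is the difference
    quotient of half length over denominator. Additive half lengths would keep it constant; a
    mediant shifts it by one denominator times the defect. *)
Lemma half_length_slope : exists2 K : R, 0 <= K & forall x y,
  farey_neighbours x y ->
  `|(denq x)%:~R * half_length y - (denq y)%:~R * half_length x| <= K.
Proof.
have [A A0 hA] := half_length_defect.
pose E x y := (denq x)%:~R * half_length y - (denq y)%:~R * half_length x.
pose s x y : R := (denq x + denq y)%:~R.
have s1 x y : 1 <= s x y.
  by rewrite ler1z; have := denq_gt0 x; have := denq_gt0 y; lia.
(* The term 2A/s pays for the defect A/s^2 accumulated at each mediant. *)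
have pot : forall x y, farey_neighbours x y ->
    `|E x y| + 2 * A / s x y <= `|E 0 1| + 2 * A / s 0 1.
  apply: farey_ind => // x y xy IH; have [dm _] := farey_mediant xy.
  have := hA _ _ xy; rewrite -/(s x y).
  set d := half_length x + _ - _ => hd.
  have b1 : 1 <= (denq x)%:~R :> R by rewrite ler1z; have := denq_gt0 x; lia.
  have b2 : 1 <= (denq y)%:~R :> R by rewrite ler1z; have := denq_gt0 y; lia.
  have sE : s x y = (denq x)%:~R + (denq y)%:~R by rewrite /s intrD.
  have pay (b : R) (e : R) : 0 <= b -> b <= s x y -> `|e| <= `|E x y| + b * `|d| ->
      `|e| + 2 * A / (s x y + b) <= `|E 0 1| + 2 * A / s 0 1.
    move=> b0 bs he; apply: le_trans IH; apply: le_trans (lerD he (lexx _)) _.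
    rewrite -addrA lerD2l.
    have S := s1 x y; set S' := s x y in S sE hd bs *.
    have dA : `|d| <= A / S' ^+ 2 by rewrite ler_pdivlMr// exprn_gt0//; lra.
    (* The right side equals 2 A b / (S' (S' + b)), and b <= S' bounds S' + b by 2 S': hence the 2
       in the potential. *)
    have h : b * (A / S' ^+ 2) <= 2 * A / S' - 2 * A / (S' + b).
      have -> : 2 * A / S' - 2 * A / (S' + b) = b * (A * (2 / (S' * (S' + b)))).
        by field; apply/andP; split; apply/eqP; lra.
      apply: ler_wpM2l => //; apply: ler_wpM2l => //.
      rewrite ler_pdivlMr; last by nra.
      rewrite mulrC ler_pdivrMr; nra.
    have := ler_wpM2l b0 dA; lra.
  have es1 : s x (mediant x y) = s x y + (denq x)%:~R.
    by rewrite /s dm !intrD; ring.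
  have es2 : s (mediant x y) y = s x y + (denq y)%:~R.
    by rewrite /s dm !intrD; ring.
  rewrite es1 es2; split; apply: pay; rewrite ?sE; try lra.
  - have -> : E x (mediant x y) = E x y + (denq x)%:~R * - d.
      by rewrite /E /d dm intrD; ring.
    rewrite (le_trans (ler_normD _ _))// lerD2l normrM normrN.
    by rewrite (ger0_norm (le_trans ler01 b1)).
  - have -> : E (mediant x y) y = E x y + (denq y)%:~R * d.
      by rewrite /E /d dm intrD; ring.
    rewrite (le_trans (ler_normD _ _))// lerD2l normrM.
    by rewrite (ger0_norm (le_trans ler01 b2)).
exists (`|E 0 1| + 2 * A / s 0 1).
  by rewrite addr_ge0// !mulr_ge0// invr_ge0; have := s1 0 1; lra.
move=> x y xy; apply: le_trans (pot _ _ xy); rewrite -/(E x y) lerDl.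
by rewrite !mulr_ge0// invr_ge0; have := s1 x y; lra.
Qed.

(** Splitting at mediants until the denominators of a pair add up to more than n decomposes the
    interval from x to y into neighbour pairs, on each of which the slope bound applies. *)
Lemma half_length_lipschitz : exists2 K : R, 0 <= K & forall x y,
  0 <= x -> x <= y -> y <= 1 ->
  `|half_length y / (denq y)%:~R - half_length x / (denq x)%:~R| <=
    K * (ratr y - ratr x).
Proof.
have [K K0 hK] := half_length_slope; exists K => //.
pose phi q := half_length q / (denq q)%:~R : R.
have dR q : 0 < (denq q)%:~R :> R by rewrite ltr0z denq_gt0.
have step x y : farey_neighbours x y -> `|phi y - phi x| <= K * (ratr y - ratr x).
  move=> xy; have [_ _ _ e] := xy.
  have -> : phi y - phi x =
      ((denq x)%:~R * half_length y - (denq y)%:~R * half_length x) /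
      ((denq x)%:~R * (denq y)%:~R).
    by rewrite /phi; field; rewrite !lt0r_neq0 ?dR.
  have -> : ratr y - ratr x = ((denq x)%:~R * (numq y)%:~R -
      (numq x)%:~R * (denq y)%:~R) / ((denq x)%:~R * (denq y)%:~R) :> R.
    by rewrite /ratr; field; rewrite !lt0r_neq0 ?dR.
  rewrite -!intrM -intrB e !intrM div1r.
  rewrite normrM [X in _ * X]ger0_norm ?invr_ge0; last by rewrite ltW// mulr_gt0.
  by rewrite ler_pM2r ?hK// invr_gt0 mulr_gt0.
suff main n : forall u w x y, farey_neighbours u w ->
    u <= x -> x <= y -> y <= w -> (denq x <= n%:Z) -> (denq y <= n%:Z) ->
    `|phi y - phi x| <= K * (ratr y - ratr x).
  move=> x y x0 xy y1.
  apply: (main (maxn `|denq x| `|denq y|)%N 0 1) => //.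
    by have := denq_gt0 x; lia.
  by have := denq_gt0 y; lia.
move=> u w; have [k] := ubnP (n.+1 - absz (denq u + denq w)%R)%N.
elim: k => // k IH in u w *; move=> hk x y uw ux xy yw xn yn.
have du := denq_gt0 u; have dw := denq_gt0 w.
have [um mw] := farey_children uw; have [dm _] := farey_mediant uw.
have ends q : u <= q -> q <= w -> denq q <= n%:Z ->
    n%:Z < denq u + denq w -> q = u \/ q = w.
  move=> uq qw qn big; have [->|nu] := eqVneq q u; [by left|].
  have [->|nw] := eqVneq q w; [by right|].
  have := @farey_denq_between u w q uw.
  by rewrite lt_neqAle eq_sym nu uq lt_neqAle nw qw => /(_ isT isT); lia.
have [small|big] := leP (denq u + denq w) n%:Z; last first.
  have [ex|ex] := ends _ ux (le_trans xy yw) xn big;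
  have [ey|ey] := ends _ (le_trans ux xy) yw yn big;
  rewrite ex ey ?subrr ?normr0 ?mulr0//; first exact: step.
  by have [_ luw _ _] := uw; move: xy; rewrite ex ey leNgt luw.
have IHl := IH u (mediant u w); have IHr := IH (mediant u w) w.
rewrite !dm in IHl IHr.
have {}IHl := IHl ltac:(lia).
have {}IHr := IHr ltac:(lia).
have [ym|my] := leP y (mediant u w); first exact: IHl.
have [mx|xm] := leP (mediant u w) x; first exact: IHr.
have mn : denq (mediant u w) <= n%:Z by rewrite dm.
have h1 := IHl x (mediant u w) um ux (ltW xm) (lexx _) xn mn.
have h2 := IHr (mediant u w) y mw (lexx _) (ltW my) yw mn yn.
have -> : phi y - phi x = (phi y - phi (mediant u w)) + (phi (mediant u w) - phi x) by ring.
by rewrite (le_trans (ler_normD _ _))// (le_trans (lerD h2 h1))//; lra.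
Qed.

End RisingTree.

(** * The encoding function *)

(* McShane's extension: the infimum of the cones K |x - p i| + f i. *)
Lemma lipschitz_extension (R : realType) (I : Type) (s : set I) (p f : I -> R)
    (K m : R) : s !=set0 -> 0 <= K ->
  (forall i j, s i -> s j -> f i - f j <= K * `|p i - p j|) ->
  (forall i, s i -> m <= f i) ->
  exists G : R -> R, [/\ forall i, s i -> G (p i) = f i,
    forall x y, G x - G y <= K * `|x - y| & forall x, m <= G x].
Proof.
move=> [i0 si0] K0 fK fm.
pose A x := [set f i + K * `|x - p i| | i in s].
have A0 x : A x !=set0 by exists (f i0 + K * `|x - p i0|), i0.
have Am x : lbound (A x) m.
  by move=> _ [i si <-]; rewrite ler_wpDr ?fm// mulr_ge0.
have Ab x : has_lbound (A x) by exists m.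
exists (fun x => inf (A x)); split.
- move=> i si; apply/le_anti/andP; split.
    by apply: ge_inf => //; exists i => //; rewrite subrr normr0 mulr0 addr0.
  apply: lb_le_inf => // _ [j sj <-].
  by have := fK _ _ si sj; lra.
- move=> x y; rewrite lerBlDl -lerBlDr; apply: lb_le_inf => // _ [j sj <-].
  rewrite lerBlDr; apply: le_trans (_ : f j + K * `|x - p j| <= _).
    by apply: ge_inf => //; exists j.
  rewrite -addrA lerD2l -mulrDr ler_wpM2l//.
  have -> : x - p j = (y - p j) + (x - y) by ring.
  exact: ler_normD.
- by move=> x; apply: lb_le_inf.
Qed.

Lemma lipschitz_continuous (R : realType) (G : R -> R) (K : R) :
  (forall x y, `|G x - G y| <= K * `|x - y|) -> continuous G.
Proof.
move=> GK x; apply/cvgrPdist_lt => e e0.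
have K1 : 0 < `|K| + 1 by rewrite ltr_wpDl.
near=> y; apply: le_lt_trans (GK x y) _.
apply: le_lt_trans (_ : (`|K| + 1) * `|x - y| < _).
  by rewrite ler_wpM2r// (le_trans (ler_norm _))// lerDl.
rewrite mulrC -ltr_pdivlMr//; near: y.
by apply: cvgr_dist_lt; [exact: cvg_id|exact: divr_gt0].
Unshelve. all: by end_near. Qed.

Lemma ratr_in01 (R : realType) (q : rat) :
  (0 <= (ratr q : R) <= 1) = (0 <= q <= 1).
Proof.
by have := ler_rat R 0 q; have := ler_rat R q 1; rewrite rmorph0 rmorph1 => -> ->.
Qed.

Lemma eq_rat_itv (R : realType) (f g : R -> R) :
  {within `[0, 1], continuous f} -> continuous g ->
  (forall q : rat, 0 <= q <= 1 -> f (ratr q) = g (ratr q)) ->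
  forall x : R, 0 <= x <= 1 -> f x = g x.
Proof.
move=> cf cg fg x /andP[].
rewrite le_eqVlt => /predU1P[<- _|x0].
  by have := fg 0 isT; rewrite rmorph0.
rewrite le_eqVlt => /predU1P[->|x1].
  by have := fg 1 isT; rewrite rmorph1.
have [cfx _ _] := (@continuous_within_itvP R R R 0 1 f ltr01).1 cf.
have x01 : x \in `]0, 1[ by rewrite in_itv/= x0.
apply/eqP; rewrite -subr_eq0 -normr_le0 leNgt; apply/negP => d0.
have cfg : {for x, continuous (f \- g)}.
  by apply: continuousB; [exact: cfx|exact: cg].
have : \forall y \near x, (0 < y < 1) && (`|(f x - g x) - (f y - g y)| < `|f x - g x|).
  near=> y; apply/andP; split.
    near: y; have := near_in_itvoo x01; apply: filterS => y.
    by rewrite in_itv.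
  by near: y; apply: cvgr_dist_lt d0.
move=> /nbhs_ballP[e /= e0 he].
have [q] := @rat_in_itvoo R x (x + e) ltac:(by rewrite ltrDl).
rewrite in_itv/= => /andP[xq qe].
have /andP[/andP[q0 q1]] : (0 < (ratr q : R) < 1) &&
    (`|(f x - g x) - (f (ratr q) - g (ratr q))| < `|f x - g x|).
  by apply: he; rewrite /ball/= distrC gtr0_norm; lra.
rewrite fg ?subrr ?subr0 ?ltxx//.
by rewrite -(ratr_in01 R) !ltW.
Unshelve. all: by end_near. Qed.

(** McShane's extension of half length over denominator is an encoding, so [xget] returns some
    encoding. Injectivity of [cosh] on nonnegative reals and density of the rationals force it to
    agree with that extension on [0,1], whose bounds it inherits. *)
Lemma encoding_spec (R : realType) (T : markov_tree R) : rising T ->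
  exists c K : R, [/\ 0 < c, 0 <= K,
    forall x : R, 0 <= x <= 1 -> c <= encoding T x,
    forall x y : R, 0 <= x <= 1 -> 0 <= y <= 1 ->
      `|encoding T x - encoding T y| <= K * `|x - y|
  & forall q : rat, 0 <= q <= 1 ->
      T q = 2 * cosh ((denq q)%:~R * encoding T (ratr q))].
Proof.
move=> hT; have [c c0 hc] := half_length_growth hT.
have [K K0 hK] := half_length_lipschitz hT.
have dR q : 0 < (denq q)%:~R :> R by rewrite ltr0z denq_gt0.
pose phi q : R := half_length T q / (denq q)%:~R.
pose S := [set q : rat | 0 <= q <= 1].
have [||||G [Gphi GK Gc]] :=
    @lipschitz_extension R rat S (fun q => ratr q) phi K c => //.
- by exists 0.
- move=> p q /andP[p0 p1] /andP[q0 q1]; apply: le_trans (ler_norm _) _.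
  have [pq|/ltW qp] := leP p q.
    have -> : `|ratr p - ratr q| = ratr q - ratr p :> R.
      by rewrite distrC ger0_norm// subr_ge0 ler_rat.
    by rewrite distrC; exact: (hK p q p0 pq q1).
  have -> : `|ratr p - ratr q| = ratr p - ratr q :> R.
    by rewrite ger0_norm// subr_ge0 ler_rat.
  exact: (hK q p q0 qp p1).
- by move=> q q01; rewrite /phi ler_pdivlMr ?hc.
have GK' x y : `|G x - G y| <= K * `|x - y|.
  by rewrite ler_norml GK andbT lerNl opprB distrC GK.
have cG : continuous G by exact: lipschitz_continuous GK'.
have Gq q : 0 <= q <= 1 -> (denq q)%:~R * G (ratr q) = half_length T q.
  by move=> q01; rewrite Gphi// /phi mulrC divfK// lt0r_neq0.
have encG : is_encoding T G.
  split; first exact: continuous_subspaceT.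
    by move=> x _; exact: le_trans (ltW c0) (Gc x).
  by move=> q q01; rewrite Gq//; have [] := half_lengthP hT q01.
have [cE E0 Eq] : is_encoding T (encoding T) by exact: xgetI encG.
have EG : forall x : R, 0 <= x <= 1 -> encoding T x = G x.
  apply: eq_rat_itv => // q q01.
  have q01R : 0 <= (ratr q : R) <= 1 by rewrite ratr_in01.
  apply: (@mulfI _ (denq q)%:~R); first by rewrite lt0r_neq0.
  apply: cosh_inj; rewrite ?mulr_ge0 ?(ltW (dR q)) ?E0//.
    exact: le_trans (ltW c0) (Gc _).
  have [_ _ Gq'] := encG.
  by apply: (@mulfI _ 2) => //; rewrite -Eq// -Gq'.
exists c, K; split => //.
- by move=> x x01; rewrite EG.
- by move=> x y x01 y01; rewrite !EG.
Qed.

(** * Dilations of the plane *)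

Section Dilation.
Context {R : realType}.
Local Notation leb := (@lebesgue_measure R).
Local Notation leb2 := (leb \x leb)%E.

(** The scaled pushforward agrees with Lebesgue measure on half-open intervals, and these determine
    it. In the plane, rectangles play the same part. *)
Lemma lebesgue_measure_dilation (a : R) (A : set (measurableTypeR R)) :
  0 < a -> measurable A ->
  (a%:E * leb (( *%R a : _ -> measurableTypeR R) @^-1` A) = leb A)%E.
Proof.
move=> a0 mA; have mf : measurable_fun setT ( *%R a : measurableTypeR R -> measurableTypeR R).
  exact: mulrl_measurable.
pose m := mscale (NngNum (ltW a0)) (pushforward leb ( *%R a : measurableTypeR R -> measurableTypeR R)).
transitivity (m mf A) => //; apply/esym.
apply: (lebesgue_measure_unique (mu := m mf)) => //= _ [[u v]] _ <-.
rewrite /m /mscale/= /pushforward.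
rewrite (_ : _ @^-1` _ = `]u / a, v / a]%classic); last first.
  apply/seteqP; split => x /=; rewrite !in_itv/=.
    by rewrite ltr_pdivrMr// ler_pdivlMr// ![x * _]mulrC.
  by rewrite ltr_pdivrMr// ler_pdivlMr// ![x * _]mulrC.
rewrite !lebesgue_measure_itv/= !lte_fin ltr_pM2r ?invr_gt0//.
case: ifP => _; last by rewrite mule0.
by rewrite -!EFinB -EFinM; congr EFin; field; rewrite lt0r_neq0.
Qed.

Definition dilate (a : R) (z : R * R) : R * R := (a * z.1, a * z.2).

Lemma measurable_dilate (a : R) :
  measurable_fun setT (dilate a : measurableTypeR R * measurableTypeR R -> measurableTypeR R * measurableTypeR R).
Proof.
apply: measurable_fun_pair.
  by apply: measurableT_comp => //; exact: mulrl_measurable.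
by apply: measurableT_comp => //; exact: mulrl_measurable.
Qed.

Lemma area_dilation (a : R) (X : set (measurableTypeR R * measurableTypeR R)) :
  0 < a -> measurable X ->
  ((a ^+ 2)%:E * leb2 (dilate a @^-1` X) = leb2 X)%E.
Proof.
move=> a0 mX; have mf := measurable_dilate a.
pose m := mscale (NngNum (sqr_ge0 a)) (pushforward leb2
  (dilate a : measurableTypeR R * measurableTypeR R ->
              measurableTypeR R * measurableTypeR R)).
transitivity (m mf X) => //; apply/esym.
apply: (product_measure_unique (m' := m mf)) => //= A B mA mB.
rewrite /m /mscale/= /pushforward.
have -> : dilate a @^-1` (A `*` B) = ( *%R a @^-1` A) `*` ( *%R a @^-1` B) by [].
have mpre C : measurable C -> measurable (( *%R a : measurableTypeR R -> measurableTypeR R) @^-1` C).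
  by move=> mC; rewrite -[X in measurable X]setTI; exact: mulrl_measurable.
rewrite product_measure1E//; [|exact: mpre|exact: mpre].
rewrite -(lebesgue_measure_dilation a0 mA) -(lebesgue_measure_dilation a0 mB).
by rewrite expr2 EFinM muleACA.
Qed.

End Dilation.

(** * Lattice points in a sector *)

(** Applied to both coordinates in turn, this cuts a bounded planar set into unit cells. *)
Lemma measure_slices (R : realType) (d : measure_display) (S : measurableType d)
    (mu : {measure set S -> \bar R}) (f : S -> R) (X : set S) (B : nat) :
  measurable_fun setT f -> measurable X ->
  (forall z, X z -> 0 <= f z < B%:R) ->
  mu X = (\sum_(n < B) mu (X `&` f @^-1` `[n%:R, n.+1%:R[))%E.
Proof.
move=> mf; have mpre (i : interval R) : measurable (f @^-1` [set` i]).
  by rewrite -[X in measurable X]setTI; apply: mf => //; exact: measurable_itv.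
elim: B X => [|B IH] X mX Xf.
  rewrite big_ord0 (_ : X = set0) ?measure0//.
  by apply/seteqP; split => // z /Xf; rewrite ltNge andbN.
pose Y := X `&` f @^-1` `]-oo, B%:R[; pose Z := X `&` f @^-1` `[B%:R, B.+1%:R[.
have mY : measurable Y by exact: measurableI.
have mZ : measurable Z by exact: measurableI.
rewrite big_ord_recr/=.
have XE : X = Y `|` Z.
  rewrite /Y /Z -setIUr; apply/seteqP; split => [z Xz|z []//]; split => //=.
  have /andP[_ zB] := Xf z Xz.
  by case: (ltP (f z) B%:R) => h; [left|right]; rewrite /= in_itv/= ?h ?zB.
rewrite {1}XE measureU//; last first.
  apply/seteqP; split => // z [[_]] /=; rewrite in_itv/= => zB [_].
  by rewrite /= in_itv/= leNgt zB.
congr (_ + _)%E.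
have YB z : Y z -> 0 <= f z < B%:R.
  by move=> [/Xf/andP[z0 _]] /=; rewrite in_itv/= z0.
apply: etrans (IH Y mY YB) _; apply: eq_bigr => n _; congr (mu _).
apply/seteqP; split => [z [[Xz _] zn]//|z [Xz zn]]; split => //; split => //=.
move: zn; rewrite /= !in_itv/= => /andP[_ zn]; apply: lt_le_trans zn _.
by rewrite ler_nat.
Qed.

Lemma rat_dense01 (R : realType) (t e : R) : 0 <= t <= 1 -> 0 < e ->
  exists2 q : rat, 0 <= q <= 1 & `|t - ratr q| < e.
Proof.
move=> /andP[t0]; rewrite le_eqVlt => /predU1P[->|t1] e0.
  by exists 1; rewrite ?rmorph1 ?subrr ?normr0.
have [|q] := @rat_in_itvoo R t (Num.min 1 (t + e)); first by rewrite lt_min t1 ltrDl.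
rewrite in_itv/= lt_min => /and3P[tq q1 qe]; exists q.
  by rewrite -(ratr_in01 R) (ltW q1) (le_trans t0 (ltW tq)).
by rewrite distrC gtr0_norm; lra.
Qed.

Section LatticePoints.
Context {R : realType}.
Variables (Phi : R -> R) (c K : R).
Hypotheses (c0 : 0 < c) (K0 : 0 <= K).
Hypothesis Phi_ge : forall x : R, 0 <= x <= 1 -> c <= Phi x.
Hypothesis Phi_lip : forall x y : R, 0 <= x <= 1 -> 0 <= y <= 1 ->
  `|Phi x - Phi y| <= K * `|x - y|.
Local Notation mR := (measurableTypeR R).
Local Notation leb := (@lebesgue_measure R).
Local Notation leb2 := (leb \x leb)%E.

(** Homogeneous of degree 1. On the axis [z.1 = 0] division by zero makes it 0, which is harmless:
    within the cone of [sector] that axis contains only the origin. *)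
Definition radial (z : R * R) : R := z.1 * Phi (z.2 / z.1).

Definition sector (rho : R) : set (R * R) :=
  [set z | 0 <= z.2 <= z.1 /\ radial z <= rho].

Lemma slope01 (x y : R) : 0 <= y <= x -> 0 <= y / x <= 1.
Proof.
move=> /andP[y0 yx]; have x0 := le_trans y0 yx.
rewrite divr_ge0//=; move: x0; rewrite le_eqVlt => /predU1P[<-|x0].
  by rewrite invr0 mulr0.
by rewrite ler_pdivrMr// mul1r.
Qed.

Lemma radial_ge (z : R * R) : 0 <= z.2 <= z.1 -> c * z.1 <= radial z.
Proof.
move=> z01; have /andP[y0 yx] := z01.
by rewrite /radial mulrC ler_wpM2l ?Phi_ge ?slope01// (le_trans y0 yx).
Qed.

Lemma sector_bounded (rho : R) (z : R * R) : sector rho z ->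
  [/\ 0 <= z.1, z.1 <= rho / c, 0 <= z.2 & z.2 <= rho / c].
Proof.
move=> [z01 zr]; have := le_trans (radial_ge z01) zr.
case/andP: z01 => y0 yx; rewrite mulrC -ler_pdivlMr// => h.
by split => //; [exact: le_trans yx|exact: le_trans h].
Qed.

(* Phi is the supremum over rational q of Phi q - K |x - q|, so the sector is cut
   out by countably many conditions free of the quotient y / x. *)
Lemma measurable_sector (rho : R) : measurable (sector rho : set (mR * mR)).
Proof.
pose g (q : rat) (z : mR * mR) : mR :=
  z.1 * Phi (ratr q) - K * `|z.2 - z.1 * ratr q|.
have m1 : measurable_fun setT (fst : mR * mR -> mR) by exact: measurable_fst.
have m2 : measurable_fun setT (snd : mR * mR -> mR) by exact: measurable_snd.
have mg q : measurable_fun setT (g q).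
  apply: measurable_funB; first by apply: measurable_funM.
  apply: measurable_funM => //; apply: measurableT_comp => //.
  by apply: measurable_funB => //; apply: measurable_funM.
have -> : sector rho = (snd : mR * mR -> mR) @^-1` `[0, +oo[ `&`
   ((fun z : mR * mR => z.1 - z.2 : mR) @^-1` `[0, +oo[) `&`
   ~` (\bigcup_(q : rat) (if 0 <= q <= 1 then g q @^-1` `]rho, +oo[ else set0)).
  apply/seteqP; split => [[x y] [/= /andP[y0 yx] zr]|[x y] [[/=]]].
    split; first by split; rewrite /= in_itv/= andbT// subr_ge0.
    move=> [q _]; case: ifP => // q01 /=; rewrite in_itv/= andbT => /lt_geF.
    have x0 := le_trans y0 yx.
    move/negP; apply; apply: le_trans zr; rewrite /g/=.
    move: x0; rewrite le_eqVlt => /predU1P[ex|x0].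
      move: yx; rewrite -ex => y0'; have -> : y = 0 by apply/le_anti/andP.
      by rewrite /radial/= !mul0r subr0 normr0 mulr0 subr0.
    have -> : y - x * ratr q = x * (y / x - ratr q).
      by field; rewrite lt0r_neq0.
    rewrite normrM (gtr0_norm x0) mulrCA -mulrBr ler_wpM2l ?(ltW x0)//.
    rewrite lerBlDr -lerBlDl distrC; apply: le_trans (ler_norm _) _.
    apply: Phi_lip; first by rewrite ratr_in01.
    by apply: slope01; rewrite y0.
  rewrite !in_itv/= !andbT subr_ge0 => y0 yx zq.
  split; first by rewrite /= y0.
  rewrite leNgt; apply/negP => rz.
  have x0 : 0 <= x by exact: le_trans yx.
  move: x0; rewrite le_eqVlt => /predU1P[ex|x0].
    apply: zq; exists 0 => //=; rewrite in_itv/= andbT /g/=.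
    have -> : y = 0 by apply/le_anti; rewrite y0 ex yx.
    by move: rz; rewrite /radial/= -ex !mul0r subr0 normr0 mulr0 subr0.
  have t01 : 0 <= y / x <= 1 by apply: slope01; rewrite y0.
  (* An error s in the slope costs K x |s| twice, once in [Phi] and once in the cone of [g]; the 1
     keeps the denominator positive when K = 0. *)
  have e0 : 0 < (radial (x, y) - rho) / (2 * K * x + 1).
    by rewrite divr_gt0 ?subr_gt0// ltr_wpDl// !mulr_ge0// ltW.
  have [q q01 tq] := rat_dense01 t01 e0.
  apply: zq; exists q => //; rewrite q01 /= in_itv/= andbT /g/=.
  have -> : y - x * ratr q = x * (y / x - ratr q).
    by field; rewrite lt0r_neq0.
  rewrite normrM (gtr0_norm x0) mulrCA -mulrBr.
  have := Phi_lip t01 (_ : 0 <= (ratr q : R) <= 1); rewrite ratr_in01 => /(_ q01).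
  move: tq; rewrite ltr_pdivlMr; last by rewrite ltr_wpDl// !mulr_ge0// ltW.
  rewrite /radial/=; move: (y / x - ratr q) (Phi (y / x)) (Phi (ratr q)) => s P Q.
  move=> h /(le_trans (ler_norm _)) h2.
  have h3 : x * (P - Q) <= x * (K * `|s|) by rewrite ler_pM2l.
  by have := normr_ge0 s; lra.
apply: measurableI; [apply: measurableI|apply: measurableC].
- by rewrite -[X in measurable X]setTI; apply: m2 => //; exact: measurable_itv.
- rewrite -[X in measurable X]setTI.
  have md : measurable_fun setT (fun z : mR * mR => z.1 - z.2 : mR) by exact: measurable_funB.
  by apply: md => //; exact: measurable_itv.
- apply: bigcupT_measurable_rat => q; case: ifP => // _.
  by rewrite -[X in measurable X]setTI; apply: mg => //; exact: measurable_itv.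
Qed.

Lemma radial_dilate (a : R) (z : R * R) : 0 < a ->
  radial (dilate a z) = a * radial z.
Proof.
move=> a0; rewrite /radial/= -mulrA; congr (_ * (_ * Phi _)).
by rewrite -mulf_div divff ?mul1r// lt0r_neq0.
Qed.

Lemma sector_dilate (rho : R) : 0 < rho ->
  sector rho = dilate rho^-1 @^-1` sector 1.
Proof.
move=> r0; have i0 : 0 < rho^-1 by rewrite invr_gt0.
apply/seteqP; split => z; rewrite /sector /preimage /= radial_dilate//=.
  move=> [/andP[y0 yx] h]; rewrite mulr_ge0 ?(ltW i0)// ler_pM2l// yx.
  by rewrite mulrC ler_pdivrMr// mul1r.
rewrite pmulr_rge0// ler_pM2l// => -[-> h].
by move: h; rewrite mulrC ler_pdivrMr// mul1r.
Qed.

Definition sector_area : R := fine (leb2 (sector 1)).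

Lemma sector_area_fin : leb2 (sector 1) = sector_area%:E.
Proof.
rewrite /sector_area fineK// ge0_fin_numE ?measure_ge0//.
pose I : set mR := `[0, 1 / c]%classic.
have mI : measurable I by exact: measurable_itv.
have sub : (sector 1 : set (mR * mR)) `<=` I `*` I.
  by move=> z /sector_bounded[? ? ? ?]; split; rewrite /I /= in_itv/=; apply/andP.
have fin : (leb2 (I `*` I) < +oo)%E.
  rewrite product_measure1E//= /I lebesgue_measure_itv/= lte_fin divr_gt0//.
  by rewrite -EFinB -EFinM ltry.
apply: le_lt_trans fin; apply: le_measure => //; rewrite inE.
- exact: measurable_sector.
- exact: measurableX.
Qed.

Lemma sector_area_ge0 : 0 <= sector_area.
Proof. by rewrite fine_ge0// measure_ge0. Qed.

Lemma leb2_sector (rho : R) : 0 < rho ->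
  leb2 (sector rho) = (sector_area * rho ^+ 2)%:E.
Proof.
move=> r0; rewrite sector_dilate//.
have i0 : 0 < rho^-1 by rewrite invr_gt0.
have := area_dilation i0 (measurable_sector 1); rewrite sector_area_fin => h.
have -> : (sector_area * rho ^+ 2)%:E = ((rho ^+ 2)%:E * sector_area%:E)%E.
  by rewrite -EFinM mulrC.
by rewrite -h muleA -EFinM exprVn divff ?mul1e// expf_neq0// lt0r_neq0.
Qed.

Definition phi_max : R := Phi 0 + K.

Lemma Phi_le (x : R) : 0 <= x <= 1 -> Phi x <= phi_max.
Proof.
move=> x01; have /andP[x0 x1] := x01.
have := Phi_lip x01 (_ : 0 <= 0 <= 1); rewrite lexx ler01 => /(_ isT).
rewrite subr0 (ger0_norm x0) => /(le_trans (ler_norm _)) h.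
by have := ler_wpM2l K0 x1; rewrite /phi_max; lra.
Qed.

Lemma cell_osc_gt0 : 0 < phi_max + K.
Proof.
have z01 : 0 <= (0 : R) <= 1 by rewrite lexx ler01.
by rewrite ltr_wpDr// (lt_le_trans c0)// (le_trans (Phi_ge z01))// Phi_le.
Qed.

(** The change of x contributes at most [phi_max]. The slope moves by at most 1 / x, which the
    factor x0 <= x absorbs, so the oscillation is bounded uniformly over all cells. *)
Lemma radial_cell (x y x0 y0 : R) : 0 < x0 -> 0 <= y0 <= x0 -> 0 <= y <= x ->
  x0 <= x < x0 + 1 -> y0 <= y < y0 + 1 ->
  `|radial (x, y) - radial (x0, y0)| <= phi_max + K.
Proof.
move=> x00 y0x0 yx /andP[xx0 xx1] /andP[yy0 yy1].
have xp : 0 < x by exact: lt_le_trans xx0.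
have s1 := slope01 yx; have s0 := slope01 y0x0.
have -> : radial (x, y) - radial (x0, y0) =
    (x - x0) * Phi (y / x) + x0 * (Phi (y / x) - Phi (y0 / x0)).
  by rewrite /radial/=; ring.
apply: le_trans (ler_normD _ _) _; apply: lerD.
  have P0 := le_trans (ltW c0) (Phi_ge s1); have PM := Phi_le s1.
  rewrite ger0_norm ?mulr_ge0//; last by lra.
  apply: le_trans PM; apply: ler_piMl => //; lra.
rewrite normrM gtr0_norm//.
apply: le_trans (_ : x0 * (K * `|y / x - y0 / x0|) <= _).
  by rewrite ler_pM2l// Phi_lip.
have -> : y / x - y0 / x0 = ((y - y0) * x0 - y0 * (x - x0)) / (x * x0).
  by field; rewrite !lt0r_neq0.
have nb : `|(y - y0) * x0 - y0 * (x - x0)| <= x0.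
  case/andP: y0x0 => y00 y0x; rewrite ler_norml; apply/andP; split; nra.
rewrite normrM (ger0_norm (_ : 0 <= (x * x0)^-1)); last by rewrite invr_ge0 mulr_ge0 ?ltW.
have -> : x0 * (K * (`|(y - y0) * x0 - y0 * (x - x0)| / (x * x0))) =
    K * (`|(y - y0) * x0 - y0 * (x - x0)| / x).
  by field; rewrite !lt0r_neq0.
by rewrite ler_piMr// ler_pdivrMr// mul1r; exact: le_trans xx0.
Qed.

Definition lattice_point (r : R) (n k : nat) : bool :=
  [&& (0 < n)%N, (k <= n)%N & radial (n%:R, k%:R) <= r].

(** The box only makes the sum finite: it holds every lattice point of the sector once r < c B. *)
Definition lattice_count (r : R) (B : nat) : R :=
  \sum_(n < B) \sum_(k < B) (lattice_point r n k)%:R.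

Definition cell (n k : nat) : set (mR * mR) :=
  (fst @^-1` `[n%:R, n.+1%:R[) `&` (snd @^-1` `[k%:R, k.+1%:R[).

Lemma leb2_cell (n k : nat) : leb2 (cell n k) = 1%E.
Proof.
pose I (i : nat) : set mR := `[i%:R, i.+1%:R[%classic.
have -> : cell n k = I n `*` I k by apply/seteqP; split.
have mI i : measurable (I i) by exact: measurable_itv.
have h i : leb (I i) = 1%E.
  rewrite /I lebesgue_measure_itv/= lte_fin ltr_nat ltnSn -EFinB.
  by rewrite -natrB// subSnn.
by rewrite product_measure1E//= !h mule1.
Qed.

Lemma measurable_cell (n k : nat) : measurable (cell n k).
Proof.
apply: measurableI; rewrite -[X in measurable X]setTI.
  by apply: measurable_fst => //; exact: measurable_itv.
by apply: measurable_snd => //; exact: measurable_itv.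
Qed.

Lemma leb2_grid (rho : R) (B : nat) : rho < c * B%:R ->
  leb2 (sector rho) = (\sum_(n < B) \sum_(k < B) leb2 (sector rho `&` cell n k))%E.
Proof.
move=> rB; have ms := measurable_sector rho.
have rB' : rho / c < B%:R by rewrite ltr_pdivrMr// mulrC.
have b1 z : sector rho z -> 0 <= z.1 < B%:R.
  by move=> /sector_bounded[-> xr _ _]; exact: le_lt_trans rB'.
apply: etrans (measure_slices leb2 measurable_fst ms b1) _.
apply: eq_bigr => n _.
have mn : measurable (sector rho `&` (fst : mR * mR -> mR) @^-1` `[n%:R, n.+1%:R[).
  apply: measurableI => //; rewrite -[X in measurable X]setTI.
  by apply: measurable_fst => //; exact: measurable_itv.
have b2 z : (sector rho `&` (fst : mR * mR -> mR) @^-1` `[n%:R, n.+1%:R[) z ->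
    0 <= z.2 < B%:R.
  by move=> [/sector_bounded[_ _ -> yr] _]; exact: le_lt_trans rB'.
apply: etrans (measure_slices leb2 measurable_snd mn b2) _.
by apply: eq_bigr => k _; rewrite setIA.
Qed.

(** Among the cells indexed by a lower left corner with 0 <= k <= n, only those with k = n are cut
    by the line y = x; they are charged to the error. *)
Definition diagonal_cell (r : R) (n k : nat) : bool :=
  (k == n) && (c * n%:R <= r).

Lemma diagonal_count (r : R) (B : nat) : 0 <= r ->
  \sum_(n < B) \sum_(k < B) ((diagonal_cell r n k)%:R : R) <= r / c + 1.
Proof.
move=> r0.
apply: le_trans (_ : \sum_(n < B) ((c * n%:R <= r)%R%:R : R) <= _).
  apply: ler_sum => n _; rewrite (bigD1 n)//= [X in _ + X]big1.
    by rewrite addr0 /diagonal_cell eqxx.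
  by move=> k; rewrite -val_eqE /diagonal_cell => /negbTE /= ->.
elim: B => [|B IH]; first by rewrite big_ord0 addr_ge0// divr_ge0// ltW.
rewrite big_ord_recr/=; case: (leP (c * B%:R) r) => [h|_]; last by rewrite addr0.
apply: le_trans (_ : B%:R + 1 <= _); last first.
  by rewrite lerD2r ler_pdivlMr// mulrC.
rewrite lerD2r; apply: le_trans (_ : \sum_(n < B) (1 : R) <= _).
  by apply: ler_sum => n _; rewrite lern1 leq_b1.
by rewrite sumr_const card_ord.
Qed.

Local Notation K' := (phi_max + K).

(** Off the diagonal k + 1 <= n, so the cell stays below y = x, and the bounded oscillation puts all
    of it in the sector enlarged by [K']. *)
Lemma sector_cell_lower (r : R) (n k : nat) :
  ((lattice_point r n k)%:R%:E <=
   leb2 (sector (r + K') `&` cell n k) + (diagonal_cell r n k)%:R%:E)%E.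
Proof.
have m0 := measure_ge0 leb2 (sector (r + K') `&` cell n k).
case: (boolP (lattice_point r n k)) => [/and3P[n0 kn rr]|_]; last first.
  by rewrite adde_ge0// lee_fin.
have n0R : 0 < n%:R :> R by rewrite ltr0n.
have kn01 : 0 <= (k%:R : R) <= n%:R by rewrite ler0n ler_nat.
have [ekn|nkn] := eqVneq k n.
  have -> : diagonal_cell r n k.
    rewrite /diagonal_cell ekn eqxx/=.
    exact: le_trans (@radial_ge (n%:R, k%:R) kn01) rr.
  exact: leeDr m0.
have -> : sector (r + K') `&` cell n k = cell n k.
  apply/seteqP; split => [z []//|[x y] zc]; split => //.
  case: zc; rewrite /= !in_itv/= => /andP[nx xn] /andP[ky yk].
  have y0 : 0 <= y by apply: le_trans ky.
  have yx : y <= x.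
    apply: le_trans (ltW yk) (le_trans _ nx).
    by rewrite ler_nat ltn_neqAle nkn.
  have yx01 : 0 <= y <= x by rewrite y0.
  split => //.
  have := @radial_cell x y n%:R k%:R n0R kn01 yx01.
  rewrite nx ky -!natr1 in xn yk *; rewrite xn yk => /(_ isT isT).
  move=> /(le_trans (ler_norm _)); lra.
rewrite leb2_cell -[leLHS]adde0 leeD2l// lee_fin//.
Qed.

Lemma sector_cell_upper (r : R) (n k : nat) : K' < r ->
  (leb2 (sector (r - K') `&` cell n k) <=
   (lattice_point r n k)%:R%:E + (diagonal_cell r n k)%:R%:E)%E.
Proof.
move=> rK.
have K'0 := ltW cell_osc_gt0.
have [->|/set0P[[x y] [sz cz]]] := eqVneq (sector (r - K') `&` cell n k) set0.
  by rewrite measure0 -EFinD lee_fin addr_ge0.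
have le1 : (leb2 (sector (r - K') `&` cell n k) <= 1)%E.
  rewrite -(leb2_cell n k); apply: le_measure; rewrite ?inE//.
    by apply: measurableI; [exact: measurable_sector|exact: measurable_cell].
  exact: measurable_cell.
apply: le_trans le1 _; rewrite -EFinD lee_fin.
have cz' := cz; case: cz'; rewrite /= !in_itv/= => /andP[nx xn] /andP[ky yk].
have [yx rz] := sz; rewrite /= in yx.
have kn : (k <= n)%N.
  rewrite -ltnS -(ltr_nat R); apply: le_lt_trans ky (le_lt_trans _ xn).
  by case/andP: yx.
have [ekn|nkn] := eqVneq k n.
  rewrite /diagonal_cell ekn eqxx/= (_ : c * n%:R <= r) ?lerDr//.
  have h := radial_ge (yx : 0 <= (x, y).2 <= (x, y).1).
  have h2 : c * n%:R <= c * x by rewrite ler_pM2l.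
  by rewrite /= in h; lra.
have n0 : (0 < n)%N by rewrite (leq_ltn_trans (leq0n k))// ltn_neqAle nkn.
rewrite /lattice_point n0 kn (_ : radial _ <= r) ?lerDl//.
have kn01 : 0 <= (k%:R : R) <= n%:R by rewrite ler0n ler_nat.
have := @radial_cell x y n%:R k%:R; rewrite ltr0n => /(_ n0 kn01 yx).
rewrite -!natr1 in xn yk; rewrite nx ky xn yk => /(_ isT isT).
by rewrite distrC => /(le_trans (ler_norm _)); lra.
Qed.

Lemma lattice_count_asymptotic : exists2 C : R, 0 <= C &
  forall (r : R) (B : nat), 0 <= r -> r + K' < c * B%:R ->
  `|lattice_count r B - sector_area * r ^+ 2| <= C * (r + 1).
Proof.
have A0 := sector_area_ge0; set A := sector_area in A0 *.
have K'0 := cell_osc_gt0.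
have ci : 0 < c^-1 by rewrite invr_gt0.
(* The terms with A bound the area between the radii r and r + K', the others the diagonal cells. A
   K'^2 also covers r <= K', where no shrunken sector is available. *)
exists (2 * A * K' + A * K' ^+ 2 + c^-1 + 1).
  by have := mulr_ge0 A0 (ltW K'0); have := sqr_ge0 K'; nra.
move=> r B r0 rB.
have diag := diagonal_count B r0.
have up : lattice_count r B <= A * (r + K') ^+ 2 + (r / c + 1).
  rewrite -lee_fin EFinD -leb2_sector; last by lra.
  apply: le_trans (_ : leb2 (sector (r + K')) +
      (\sum_(n < B) \sum_(k < B) ((diagonal_cell r n k)%:R : R))%:E <= _)%E.
    rewrite (leb2_grid rB) /lattice_count.
    rewrite -!sumEFin -big_split/=; apply: lee_sum => n _.
    rewrite -!sumEFin -big_split/=; apply: lee_sum => k _.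
    exact: sector_cell_lower.
  by rewrite leeD2l// lee_fin.
have low : K' < r -> A * (r - K') ^+ 2 <= lattice_count r B + (r / c + 1).
  move=> Kr; rewrite -lee_fin EFinD -leb2_sector; last by lra.
  apply: le_trans (_ : (lattice_count r B)%:E +
      (\sum_(n < B) \sum_(k < B) ((diagonal_cell r n k)%:R : R))%:E <= _)%E.
    rewrite (@leb2_grid _ B); last by lra.
    rewrite /lattice_count.
    rewrite -!sumEFin -big_split/=; apply: lee_sum => n _.
    rewrite -!sumEFin -big_split/=; apply: lee_sum => k _.
    exact: sector_cell_upper.
  by rewrite leeD2l// lee_fin.
have AK := mulr_ge0 A0 (ltW K'0); have AK2 := mulr_ge0 A0 (sqr_ge0 K').
have rc : 0 <= r / c by rewrite divr_ge0// ltW.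
have ArK := mulr_ge0 AK r0; have AK2r := mulr_ge0 AK2 r0.
rewrite ler_norml; apply/andP; split; last first.
  move: up; move: (lattice_count r B) => N; lra.
have [Kr|rK] := ltP K' r.
  move: (low Kr); move: (lattice_count r B) => N; lra.
have N0 : 0 <= lattice_count r B by apply: sumr_ge0 => n _; apply: sumr_ge0.
have : A * r ^+ 2 <= A * K' ^+ 2 by rewrite ler_wpM2l// lerXn2r ?nnegrE// ltW.
move: N0; move: (lattice_count r B) => N; lra.
Qed.

End LatticePoints.

(** * Moebius inversion and the Basel problem *)

Section Mobius.
Context {R : realType}.

Definition mobius (n : nat) : R :=
  if all (fun p => logn p n == 1%N) (primes n) then (-1) ^+ size (primes n) else 0.

Lemma mobius_norm_le1 n : `|mobius n| <= 1.
Proof. by rewrite /mobius; case: ifP; rewrite ?normr0// normrX normrN1 expr1n. Qed.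

Lemma mobius1 : mobius 1 = 1.
Proof. by []. Qed.

Lemma mobius_sqr p n : prime p -> (0 < n)%N -> (p ^ 2 %| n)%N -> mobius n = 0.
Proof.
move=> pp n0 p2n; rewrite /mobius; case: allP => // h.
have : p \in primes n.
  by rewrite mem_primes pp n0 (dvdn_trans _ p2n)// dvdn_exp.
by move=> /h/eqP pn; move: p2n; rewrite pfactor_dvdn// pn.
Qed.

Lemma mobius_prime p n : prime p -> (0 < n)%N -> ~~ (p %| n)%N ->
  mobius (p * n) = - mobius n.
Proof.
move=> pp n0 pn; have p0 := prime_gt0 pp.
have pnp : p \notin primes n by rewrite mem_primes pp n0.
have per : perm_eq (primes (p * n)) (p :: primes n).
  apply: uniq_perm; rewrite ?primes_uniq//= ?pnp ?primes_uniq//.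
  by move=> q; rewrite primesM// inE primes_prime// inE.
rewrite /mobius (perm_all _ per) (perm_size per)/=.
rewrite lognM// logn_prime// eqxx (lognE p n) pp n0 (negbTE pn) addn0 eqxx/=.
rewrite (eq_in_all (a2 := fun q => logn q n == 1%N)).
  by case: ifP => _; rewrite ?oppr0// exprS mulN1r.
move=> q qn; rewrite lognM// logn_prime//.
by case: (q =P p) => // e; move: pnp qn; rewrite e => /negbTE ->.
Qed.

(** For a prime p dividing n, divisors divisible by p^2 contribute 0, and d -> p d pairs the
    remaining ones with opposite signs. *)
Lemma mobius_sum n : (0 < n)%N -> \sum_(d <- divisors n) mobius d = (n == 1)%N%:R.
Proof.
move=> n0; have [->|n1] := eqVneq n 1%N; first by rewrite big_seq1 mobius1.
have ngt1 : (1 < n)%N by rewrite ltn_neqAle eq_sym n1.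
have pp := pdiv_prime ngt1; set p := pdiv n in pp *.
have pn : (p %| n)%N by exact: pdiv_dvd.
have p0 := prime_gt0 pp.
rewrite (bigID (fun d => p %| d)%N)/= (bigID (fun d => p ^ 2 %| d)%N)/=.
rewrite big_seq_cond big1 ?add0r; last first.
  move=> d /andP[dn /andP[pd p2d]]; apply: mobius_sqr p2d => //.
  by move: dn; rewrite -dvdn_divisors// => /dvdn_gt0; exact.
rewrite -big_filter -[X in _ + X]big_filter.
set s2 := [seq d <- divisors n | ~~ (p %| d)%N].
have per : perm_eq [seq d <- divisors n | (p %| d)%N && ~~ (p ^ 2 %| d)%N]
    [seq (p * d)%N | d <- s2].
  apply: uniq_perm; rewrite ?filter_uniq ?divisors_uniq//.
    rewrite map_inj_uniq ?filter_uniq ?divisors_uniq//.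
    by move=> a b /eqP; rewrite eqn_pmul2l// => /eqP.
  move=> d; rewrite mem_filter -dvdn_divisors//; apply/idP/mapP.
    move=> /andP[/andP[/dvdnP[e ->] p2] en]; exists e; last by rewrite mulnC.
    rewrite mem_filter -dvdn_divisors// (dvdn_trans _ en) ?dvdn_mulr// andbT.
    by apply: contra p2 => pe; rewrite expnS expn1 dvdn_mul.
  move=> [e]; rewrite mem_filter -dvdn_divisors// => /andP[pe en] ->.
  rewrite dvdn_mulr//= expnS expn1 dvdn_pmul2l// pe/=.
  by rewrite Gauss_dvd ?pn ?en// prime_coprime.
rewrite (perm_big _ per)/= big_map -big_split/= big_seq big1// => d.
rewrite mem_filter -dvdn_divisors// => /andP[pd dn].
by rewrite mobius_prime// ?addNr// (dvdn_gt0 n0 dn).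
Qed.

Lemma sum_multiples (e : nat -> R) (D d : nat) : (0 < d)%N ->
  \sum_(1 <= j < (D %/ d).+1) e (d * j)%N = \sum_(1 <= n < D.+1 | (d %| n)%N) e n.
Proof.
move=> d0; rewrite -[RHS]big_filter.
have per : perm_eq [seq n <- index_iota 1 D.+1 | (d %| n)%N]
    [seq (d * j)%N | j <- index_iota 1 (D %/ d).+1].
  apply: uniq_perm; rewrite ?filter_uniq ?iota_uniq//.
    rewrite map_inj_uniq ?iota_uniq// => a b /eqP.
    by rewrite eqn_pmul2l// => /eqP.
  move=> n; rewrite mem_filter mem_index_iota; apply/idP/mapP.
    move=> /andP[/dvdnP[j ->] /andP[j1 jD]]; exists j; last by rewrite mulnC.
    rewrite ltnS in jD; rewrite mem_index_iota ltnS leq_divRL// jD andbT.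
    by move: j1; rewrite muln_gt0 => /andP[].
  move=> [j]; rewrite mem_index_iota ltnS leq_divRL// => /andP[j1 jD] ->.
  by rewrite dvdn_mulr//= muln_gt0 d0 j1 ltnS mulnC.
by rewrite (perm_big _ per)/= big_map.
Qed.

(** The cutoffs [D %/ d] make the identity exact: grouping by n = d j leaves e n times the sum of
    [mobius] over the divisors of n. *)
Lemma mobius_inversion (e : nat -> R) (D : nat) : (0 < D)%N ->
  \sum_(1 <= d < D.+1) mobius d * \sum_(1 <= j < (D %/ d).+1) e (d * j)%N = e 1%N.
Proof.
move=> D0.
transitivity (\sum_(1 <= d < D.+1) \sum_(1 <= n < D.+1)
    (if (d %| n)%N then mobius d * e n else 0)).
  rewrite !big_nat; apply: eq_bigr => d /andP[d1 _].
  by rewrite sum_multiples// mulr_sumr [RHS]big_mkcond/= -big_mkcond.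
rewrite exchange_big/=.
transitivity (\sum_(1 <= n < D.+1) (n == 1)%N%:R * e n).
  rewrite !big_nat; apply: eq_bigr => n /andP[n1 nD].
  rewrite -big_mkcond/= -mobius_sum// mulr_suml -big_filter.
  apply: perm_big; apply: uniq_perm; rewrite ?filter_uniq ?iota_uniq ?divisors_uniq//.
  move=> d; rewrite mem_filter mem_index_iota -dvdn_divisors//.
  case dn: (d %| n)%N => //=; rewrite (dvdn_gt0 n1 dn)/= ltnS.
  by rewrite (leq_trans (dvdn_leq n1 dn)).
rewrite big_ltn//= mul1r big_nat big1 ?addr0// => n /andP[n2 _].
by rewrite gtn_eqF// mul0r.
Qed.

End Mobius.

(** * The Basel sum with a rate of convergence *)

Section Basel.
Context {R : realType}.

Lemma sin_le_id (x : R) : 0 < x -> x < pi / 2 -> sin x <= x.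
Proof.
move=> x0 x2.
have [|c cx] := @MVT R sin cos 0 x x0 (fun y _ => is_derive_sin y).
  by apply: continuous_subspaceT; exact: continuous_sin.
rewrite sin0 !subr0 => ->; rewrite ler_piMl ?cos_le1//; exact: ltW.
Qed.

Lemma id_le_tan (x : R) : 0 < x -> x < pi / 2 -> x <= tan x.
Proof.
move=> x0 x2.
have cp y : 0 <= y <= x -> 0 < cos y.
  move=> /andP[y0 yx]; apply: cos_gt0_pihalf; rewrite (le_lt_trans yx x2) andbT.
  by apply: lt_le_trans y0; rewrite oppr_lt0 divr_gt0// pi_gt0.
have [||c cx] := @MVT R tan (fun y => (cos y)^-2) 0 x x0.
- move=> y; rewrite in_itv/= => /andP[y0 yx]; apply: is_derive_tan.
  by rewrite lt0r_neq0// cp// !ltW.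
- apply: continuous_in_subspaceT => y; rewrite inE/= in_itv/= => yx.
  by apply: continuous_tan; rewrite lt0r_neq0// cp.
rewrite tan0 !subr0 => ->; rewrite ler_peMl ?(ltW x0)//.
move: cx; rewrite in_itv/= => /andP[c1 c2].
have cc : 0 < cos c by rewrite cp// !ltW.
by rewrite invf_ge1 ?exprn_gt0// expr_le1 ?cos_le1// ltW.
Qed.

Lemma sum_fold (f : nat -> R) (m : nat) :
  \sum_(k < m + m) f k = \sum_(k < m) (f k + f (m + m - k.+1)%N).
Proof.
rewrite big_split_ord/= big_split/=; congr (_ + _).
rewrite (reindex_inj rev_ord_inj)/=; apply: eq_bigr => k _.
by rewrite addnBA.
Qed.

(** The odd multiples of pi / 2^(n+2) below pi / 2. Half of such an angle, and the complement of
    that half to pi / 2, both belong to level n + 1. *)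
Definition csc_angle (n k : nat) : R := (k.*2.+1)%:R * pi / 2 ^+ n.+2.

Lemma csc_angle_itv n k : (k < 2 ^ n)%N -> 0 < csc_angle n k < pi / 2.
Proof.
move=> kn; rewrite /csc_angle; apply/andP; split.
  by apply: divr_gt0; [rewrite mulr_gt0 ?pi_gt0|exact: exprn_gt0].
have h : (k.*2.+1)%:R < 2 ^+ n.+1 :> R.
  by rewrite -natrX ltr_nat expnS mul2n ltn_Sdouble.
rewrite ltr_pdivrMr ?exprn_gt0// (_ : pi / 2 * 2 ^+ n.+2 = 2 ^+ n.+1 * pi).
  by rewrite ltr_pM2r ?pi_gt0.
by rewrite (exprS _ n.+1); field.
Qed.

(* Hofbauer: csc^2 x + csc^2 (pi/2 - x) = 4 csc^2 (2 x). *)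
Lemma csc_sum n : \sum_(k < 2 ^ n) (sin (csc_angle n k)) ^- 2 = 2 * 4 ^+ n.
Proof.
elim: n => [|n IH].
  rewrite big_ord_recl big_ord0 addr0 /csc_angle/= expr0 mulr1 mul1r.
  have -> : pi / 2 ^+ 2 = pi / 4 :> R by congr (_ / _); ring.
  have s4 : sin (pi / 4) = cos (pi / 4) :> R.
    by rewrite -cosBpihalf -cosN; congr cos; field.
  have h := cos2Dsin2 (pi / 4 : R); rewrite -s4 in h.
  have -> : sin (pi / 4) ^+ 2 = 2^-1 :> R by lra.
  by rewrite invrK.
rewrite expnS mul2n -addnn (sum_fold (fun k => (sin (csc_angle n.+1 k)) ^- 2)).
rewrite exprS mulrCA -IH mulr_sumr.
apply: eq_bigr => k _.
have /andP[a0 a1] := csc_angle_itv (ltn_ord k).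
set x := csc_angle n.+1 k.
have ex : csc_angle n k = x *+ 2.
  by rewrite /x /csc_angle (exprS _ n.+2) mulr2n; field; rewrite expf_neq0.
have -> : csc_angle n.+1 (2 ^ n + 2 ^ n - k.+1) = pi / 2 - x.
  rewrite /x /csc_angle.
  have -> : ((2 ^ n + 2 ^ n - k.+1).*2.+1)%:R = 2 ^+ n.+2 - (k.*2.+1)%:R :> R.
    rewrite -natrX -natrB.
      by congr _%:R; have := ltn_ord k; rewrite !expnS; lia.
    by have := ltn_ord k; rewrite !expnS; lia.
  by rewrite (exprS _ n.+2); field; rewrite expf_neq0.
rewrite ex in a0 a1 *.
have s0 : 0 < sin x by apply: sin_gt0_pihalf; lra.
have c0 : 0 < cos x by apply: cos_gt0_pihalf; lra.
have -> : sin (pi / 2 - x) = cos x.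
  by rewrite -cosBpihalf -cosN; congr cos; lra.
rewrite sin_mulr2n.
have h := cos2Dsin2 x.
have -> : (sin x) ^- 2 + (cos x) ^- 2 = (cos x ^+ 2 + sin x ^+ 2) / (sin x * cos x) ^+ 2.
  by field; rewrite !lt0r_neq0.
rewrite h.
by field; rewrite !lt0r_neq0.
Qed.

Definition odd_inv_sqr_sum (m : nat) : R := \sum_(k < m) ((k.*2.+1)%:R ^- 2).

(** Sum csc^2 x - 1 = cot^2 x <= x^-2 <= csc^2 x over the 2^n angles; the loss of 1 per angle
    becomes the error term. *)
Lemma odd_inv_sqr_sum_bounds n :
  pi ^+ 2 / 8 - pi ^+ 2 / 16 / 2 ^+ n <= odd_inv_sqr_sum (2 ^ n) <= pi ^+ 2 / 8.
Proof.
have p0 := pi_gt0 R; have e0 : 0 < 2 ^+ n :> R by exact: exprn_gt0.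
have e4 : 4 ^+ n = 2 ^+ n * 2 ^+ n :> R by rewrite -exprMn; congr (_ ^+ _); ring.
have key k : (k < 2 ^ n)%N ->
    (sin (csc_angle n k)) ^- 2 - 1 <= (csc_angle n k) ^- 2 <= (sin (csc_angle n k)) ^- 2.
  move=> kn; have /andP[x0 x2] := csc_angle_itv kn; set x := csc_angle n k in x0 x2 *.
  have s0 : 0 < sin x by apply: sin_gt0_pihalf; rewrite x0.
  have c0 : 0 < cos x by apply: cos_gt0_pihalf; rewrite x2 andbT; lra.
  apply/andP; split; last first.
    by rewrite lef_pV2 ?posrE ?exprn_gt0// lerXn2r ?nnegrE ?(ltW s0) ?(ltW x0)// sin_le_id.
  have h := id_le_tan x0 x2; rewrite /tan in h.
  have -> : (sin x) ^- 2 - 1 = (sin x / cos x) ^- 2.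
    have := cos2Dsin2 x => hh.
    have -> : (sin x / cos x) ^- 2 = (1 - sin x ^+ 2) / sin x ^+ 2.
      rewrite -hh; field; rewrite !lt0r_neq0//.
    by field; rewrite !lt0r_neq0.
  have t0 := divr_gt0 s0 c0.
  by rewrite lef_pV2 ?posrE ?exprn_gt0// lerXn2r ?nnegrE ?(ltW x0) ?(ltW t0).
have E : \sum_(k < 2 ^ n) (csc_angle n k) ^- 2 =
    16 * 4 ^+ n / pi ^+ 2 * odd_inv_sqr_sum (2 ^ n).
  rewrite /odd_inv_sqr_sum mulr_sumr; apply: eq_bigr => k _.
  rewrite /csc_angle e4 (exprS _ n.+1) (exprS _ n).
  have a0 : 0 < k.*2.+1%:R :> R by rewrite ltr0n.
  move: (2 ^+ n) e0 (k.*2.+1%:R) a0 pi p0 => e e0 a a0 p p0.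
  by field; rewrite !lt0r_neq0.
have lo : 2 * 4 ^+ n - 2 ^+ n <= 16 * 4 ^+ n / pi ^+ 2 * odd_inv_sqr_sum (2 ^ n).
  rewrite -E -csc_sum.
  have -> : 2 ^+ n = \sum_(k < 2 ^ n) (1 : R) by rewrite sumr_const card_ord natrX.
  rewrite -sumrB; apply: ler_sum => k _.
  by have /andP[] := key k (ltn_ord k).
have up : 16 * 4 ^+ n / pi ^+ 2 * odd_inv_sqr_sum (2 ^ n) <= 2 * 4 ^+ n.
  rewrite -E -csc_sum; apply: ler_sum => k _.
  by have /andP[] := key k (ltn_ord k).
rewrite e4 in lo up; move: (odd_inv_sqr_sum _) lo up => O.
move: (2 ^+ n) e0 pi p0 => e e0 p p0 lo up.
have c0 : 0 < p ^+ 2 / (16 * (e * e)) :> R.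
  by rewrite divr_gt0 ?exprn_gt0// !mulr_gt0.
have EO : p ^+ 2 / (16 * (e * e)) * (16 * (e * e) / p ^+ 2 * O) = O.
  by field; rewrite !lt0r_neq0.
apply/andP; split.
  have := ler_wpM2l (ltW c0) lo; rewrite EO; apply: le_trans; rewrite le_eqVlt.
  by apply/orP; left; apply/eqP; field; rewrite lt0r_neq0.
have := ler_wpM2l (ltW c0) up; rewrite EO => /le_trans; apply; rewrite le_eqVlt.
by apply/orP; left; apply/eqP; field; rewrite lt0r_neq0.
Qed.

Definition inv_sqr_sum (m : nat) : R := \sum_(1 <= j < m.+1) j%:R ^- 2.

Lemma inv_sqr_sum_tail m n : (0 < m)%N -> (m <= n)%N ->
  0 <= inv_sqr_sum n - inv_sqr_sum m <= m%:R^-1 - n%:R^-1.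
Proof.
move=> m0; elim: n => [|n IH]; first by rewrite leqn0 => /eqP mz; rewrite mz in m0.
rewrite leq_eqVlt => /predU1P[<-|]; first by rewrite !subrr lexx.
rewrite ltnS => mn; have /andP[h1 h2] := IH mn.
rewrite /inv_sqr_sum big_nat_recr//= -/(inv_sqr_sum n) -/(inv_sqr_sum m).
have n0 : 0 < n%:R :> R by rewrite ltr0n (leq_trans m0).
have nS : n.+1%:R = n%:R + 1 :> R by rewrite -natr1.
have h3 : 0 <= n.+1%:R ^- 2 :> R by rewrite invr_ge0 exprn_ge0.
have h4 : n.+1%:R ^- 2 <= n%:R^-1 - n.+1%:R^-1 :> R.
  rewrite nS; move: (n%:R) n0 => x x0.
  rewrite (_ : x^-1 - (x + 1)^-1 = (x * (x + 1))^-1); last first.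
    by field; apply/andP; split; apply/eqP; lra.
  rewrite lef_pV2 ?posrE ?exprn_gt0 ?mulr_gt0//; [|lra..].
  by nra.
move: (inv_sqr_sum n) (inv_sqr_sum m) (n.+1%:R ^- 2) h1 h2 h3 h4 => a b u.
by move: (n%:R^-1) (n.+1%:R^-1) (m%:R^-1) => v w t; lra.
Qed.

Lemma inv_sqr_sum_double m :
  inv_sqr_sum m.*2 = odd_inv_sqr_sum m + inv_sqr_sum m / 4.
Proof.
elim: m => [|m IH].
  by rewrite /inv_sqr_sum /odd_inv_sqr_sum big_ord0 !big_geq// mul0r addr0.
rewrite doubleS {1}/inv_sqr_sum big_nat_recr//= big_nat_recr//= -/(inv_sqr_sum _) IH.
rewrite /odd_inv_sqr_sum big_ord_recr/= -/(odd_inv_sqr_sum m).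
rewrite {2}/inv_sqr_sum big_nat_recr//= -/(inv_sqr_sum m).
have -> : m.*2.+2%:R = 2 * m.+1%:R :> R by rewrite -natrM mul2n.
have x0 : 0 < m.+1%:R :> R by rewrite ltr0n.
have y0 : 0 < m.*2.+1%:R :> R by rewrite ltr0n.
move: (m.+1%:R) x0 (m.*2.+1%:R) y0 => x x0 y y0.
by field; rewrite !lt0r_neq0.
Qed.

(** For the supremum z, splitting off even terms along m = 2^n gives z = pi^2 / 8 + z / 4. The rate
    1 / m comes from the telescoping tail. *)
Lemma basel m : (0 < m)%N ->
  0 <= pi ^+ 2 / 6 - inv_sqr_sum m <= m%:R^-1.
Proof.
have inv0 n : 0 <= n%:R^-1 :> R by rewrite invr_ge0.
pose S := range inv_sqr_sum; pose z := sup S.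
have mono i j : (0 < i)%N -> (i <= j)%N -> inv_sqr_sum i <= inv_sqr_sum j.
  by move=> i0 ij; have /andP[h _] := inv_sqr_sum_tail i0 ij; lra.
have bound i j : (0 < i)%N -> inv_sqr_sum j <= inv_sqr_sum i + i%:R^-1.
  move=> i0; have [ij|/ltnW ji] := leqP i j.
    by have /andP[_ h] := inv_sqr_sum_tail i0 ij; have := inv0 j; lra.
  have [->|j0] := posnP j.
    rewrite {1}/inv_sqr_sum big_geq// addr_ge0 ?inv0//.
    by apply: sumr_ge0 => k _; rewrite invr_ge0 exprn_ge0.
  by have := mono _ _ j0 ji; have := inv0 i; lra.
have S0 : S !=set0 by exists (inv_sqr_sum 0), 0%N.
have Sb : has_ubound S.
  by exists (inv_sqr_sum 1 + 1%:R^-1) => _ [j _ <-]; exact: bound.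
have zlo i : inv_sqr_sum i <= z by apply: ub_le_sup => //; exists i.
have zhi i : (0 < i)%N -> z <= inv_sqr_sum i + i%:R^-1.
  by move=> i0; apply: ge_sup => // _ [j _ <-]; exact: bound.
suff -> : pi ^+ 2 / 6 = z.
  by move=> m0; have := zlo m; have := zhi m m0; rewrite subr_ge0 lerBlDl => -> ->.
have near n : `|z - pi ^+ 2 / 6| <= (2 + pi ^+ 2) / (2 ^ n)%:R.
  have n0 : (0 < 2 ^ n)%N by rewrite expn_gt0.
  have N0 : 0 < (2 ^ n)%:R :> R by rewrite ltr0n.
  have n2 : (0 < (2 ^ n).*2)%N by rewrite double_gt0.
  have h1 := zlo (2 ^ n)%N; have h2 := zhi _ n0.
  have h3 := zlo (2 ^ n).*2; have h4 := zhi _ n2.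
  have /andP[h5 h6] := odd_inv_sqr_sum_bounds n.
  have h7 := inv_sqr_sum_double (2 ^ n).
  have h8 : (2 ^ n).*2%:R^-1 <= (2 ^ n)%:R^-1 :> R.
    by rewrite lef_pV2 ?posrE ?ltr0n// ler_nat -addnn leq_addl.
  rewrite -natrX in h5.
  have p2 : 0 <= pi ^+ 2 :> R by exact: sqr_ge0.
  have q2 : 0 <= pi ^+ 2 / (2 ^ n)%:R :> R by rewrite divr_ge0// ltW.
  rewrite (mulrAC _ 16^-1) in h5; rewrite mulrDl ler_norml.
  move: h1 h2 h3 h4 h5 h6 h7 h8 p2 q2.
  move: (inv_sqr_sum (2 ^ n)) (inv_sqr_sum (2 ^ n).*2) (odd_inv_sqr_sum (2 ^ n)) => a b o.
  move: (pi ^+ 2 / (2 ^ n)%:R) => q.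
  move: (pi ^+ 2) ((2 ^ n)%:R^-1) ((2 ^ n).*2%:R^-1) => p v u.
  by move=> h1 h2 h3 h4 h5 h6 h7 h8 p2 q2; apply/andP; split; lra.
apply/esym/eqP; rewrite -subr_eq0 -normr_le0 leNgt; apply/negP => d0.
set d := `|_| in near d0.
have C0 : 0 <= 2 + pi ^+ 2 :> R by rewrite addr_ge0 ?sqr_ge0.
pose n := Num.bound ((2 + pi ^+ 2) / d).
have := near n; rewrite ler_pdivlMr ?ltr0n ?expn_gt0// leNgt => /negP; apply.
rewrite mulrC -ltr_pdivrMr//; apply: lt_le_trans (archi_boundP _) _.
  by rewrite divr_ge0// ltW.
by rewrite ler_nat ltnW// ltn_expl.
Qed.

End Basel.

(** * Primitive lattice points *)

Lemma harmonic_le (R : realType) (D : nat) : (0 < D)%N ->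
  \sum_(1 <= d < D.+1) (d%:R^-1 : R) <= 1 + ln D%:R.
Proof.
case: D => // D _; elim: D => [|D IH].
  by rewrite big_nat1 invr1 ln1 addr0.
rewrite big_nat_recr//=; apply: le_trans (lerD IH (lexx _)) _.
have D0 : 0 < D.+1%:R :> R by rewrite ltr0n.
have D1 : 0 < D.+2%:R :> R by rewrite ltr0n.
rewrite -addrA lerD2l -lerBrDl.
have e : D.+2%:R = D.+1%:R + 1 :> R by rewrite -natr1.
have -> : ln D.+2%:R - ln D.+1%:R = - ln (1 + - D.+2%:R^-1) :> R.
  rewrite -opprB -ln_div ?posrE//; congr (- ln _); rewrite e.
  move: (D.+1%:R) D0 => x x0; field; apply/eqP; lra.
rewrite lerNr; apply: le_ln1Dx.
by rewrite ltrN2 invf_lt1// e; lra.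
Qed.

Section PrimitivePoints.
Context {R : realType}.
Variables (Phi : R -> R) (c K : R).
Hypotheses (c0 : 0 < c) (K0 : 0 <= K).
Hypothesis Phi_ge : forall x : R, 0 <= x <= 1 -> c <= Phi x.
Hypothesis Phi_lip : forall x y : R, 0 <= x <= 1 -> 0 <= y <= 1 ->
  `|Phi x - Phi y| <= K * `|x - y|.
Local Notation lp := (lattice_point Phi).

Definition grid (B : nat) : seq (nat * nat) :=
  [seq (n, k) | n <- iota 0 B, k <- iota 0 B].

Lemma mem_grid B p : (p \in grid B) = (p.1 < B)%N && (p.2 < B)%N.
Proof.
case: p => n k; apply/allpairsP/idP => [[[a b] [/=]]|/andP[nB kB]].
  by rewrite !mem_iota/= => aB bB [-> ->]; rewrite aB bB.
by exists (n, k); rewrite !mem_iota.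
Qed.

Lemma grid_uniq B : uniq (grid B).
Proof. by rewrite allpairs_uniq ?iota_uniq// => -[a b] [a' b']. Qed.

Lemma sum_grid B (f : nat -> nat -> R) :
  \sum_(n < B) \sum_(k < B) f n k = \sum_(p <- grid B) f p.1 p.2.
Proof.
have iotaE : iota 0 B = index_iota 0 B by rewrite /index_iota subn0.
rewrite /grid iotaE big_allpairs/= big_mkord.
by apply: eq_bigr => n _; rewrite big_mkord.
Qed.

Definition primitive_count (r : R) (B : nat) : R :=
  \sum_(p <- grid B) ((coprime p.1 p.2) && lp r p.1 p.2)%:R.

Lemma lattice_point_le r n k : lp r n k -> c * n%:R <= r.
Proof.
move=> /and3P[n0 kn h]; apply: le_trans h.
by apply: (@radial_ge R Phi c Phi_ge (n%:R, k%:R)); rewrite /= ler0n ler_nat.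
Qed.

Lemma lattice_point_scale r j n k : (0 < j)%N ->
  lp r (j * n) (j * k) = lp (r / j%:R) n k.
Proof.
move=> j0; rewrite /lattice_point muln_gt0 j0 leq_pmul2l//; congr [&& _, _ & _].
have j0R : 0 < j%:R :> R by rewrite ltr0n.
rewrite !natrM -[_ <= r]/(radial Phi (dilate j%:R (n%:R, k%:R)) <= r).
by rewrite radial_dilate// mulrC ler_pdivlMr.
Qed.

(** Points of gcd j are j times primitive points, and homogeneity moves the factor j into the
    radius. The gcd is at most n <= s / c, so J terms suffice, and one box serves all of them. *)
Lemma count_by_gcd (s : R) (B J : nat) : s < c * B%:R -> s < c * J.+1%:R ->
  lattice_count Phi s B = \sum_(1 <= j < J.+1) primitive_count (s / j%:R) B.
Proof.
move=> sB sJ; rewrite /lattice_count (sum_grid B (fun n k => (lp s n k)%:R)).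
transitivity (\sum_(p <- grid B) \sum_(1 <= j < J.+1)
    ((gcdn p.1 p.2 == j) && lp s p.1 p.2)%:R : R).
  apply: eq_bigr => -[n k] _ /=.
  case: (boolP (lp s n k)) => [nk|_]; last first.
    by rewrite big1// => j _; rewrite andbF.
  have /and3P[n0 kn _] := nk.
  have g0 : (0 < gcdn n k)%N by rewrite gcdn_gt0 n0.
  have gJ : (gcdn n k < J.+1)%N.
    apply: leq_ltn_trans (dvdn_leq n0 (dvdn_gcdl n k)) _.
    rewrite -(ltr_nat R) -(ltr_pM2l c0).
    exact: le_lt_trans (lattice_point_le nk) sJ.
  rewrite (big_rem (gcdn n k))/=; last by rewrite mem_index_iota g0.
  rewrite eqxx big_seq big1 ?addr0// => j.
  by rewrite mem_rem_uniq ?iota_uniq// inE andbT => /andP[/negbTE jn _]; rewrite eq_sym jn.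
rewrite exchange_big/= big_nat [RHS]big_nat; apply: eq_bigr => j /andP[j0 _].
rewrite /primitive_count.
have toE (P : pred (nat * nat)) : \sum_(p <- grid B) (P p)%:R =
    \sum_(p <- [seq p <- grid B | P p]) 1 :> R.
  by rewrite big_filter [RHS]big_mkcond/=; apply: eq_bigr => p _; case: (P p).
rewrite (toE (fun p => (gcdn p.1 p.2 == j) && lp s p.1 p.2)).
rewrite (toE (fun p => coprime p.1 p.2 && lp (s / j%:R) p.1 p.2)).
set s1 := [seq _ <- _ | _]; set s2 := [seq _ <- _ | _].
have per : perm_eq s1 [seq ((j * p.1)%N, (j * p.2)%N) | p <- s2].
  apply: uniq_perm; rewrite ?filter_uniq ?grid_uniq//.
    rewrite map_inj_uniq ?filter_uniq ?grid_uniq// => -[a b] [a' b'] /= [].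
    by move=> /eqP + /eqP; rewrite !eqn_pmul2l// => /eqP -> /eqP ->.
  move=> [n k]; rewrite mem_filter mem_grid/=; apply/idP/mapP.
    move=> /andP[/andP[/eqP g nk] /andP[nB kB]].
    have /dvdnP[n' en] : (j %| n)%N by rewrite -g dvdn_gcdl.
    have /dvdnP[k' ek] : (j %| k)%N by rewrite -g dvdn_gcdr.
    exists (n', k'); last by rewrite en ek /= ![(j * _)%N]mulnC.
    rewrite mem_filter mem_grid/= -lattice_point_scale//.
    rewrite ![(j * _)%N]mulnC -en -ek nk andbT.
    rewrite (leq_ltn_trans _ nB) ?en ?leq_pmulr//.
    rewrite (leq_ltn_trans _ kB) ?ek ?leq_pmulr// !andbT.
    move: g; rewrite en ek -muln_gcdl /coprime => /eqP.
    by rewrite -[X in _ == X]mul1n eqn_pmul2r.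
  move=> [[n' k']]; rewrite mem_filter mem_grid/= -lattice_point_scale//.
  move=> /andP[/andP[cop nk] _] [-> ->].
  rewrite nk -muln_gcdr (eqP cop) muln1 eqxx/=.
  have nB : (j * n' < B)%N.
    rewrite -(ltr_nat R) -(ltr_pM2l c0); exact: le_lt_trans (lattice_point_le nk) sB.
  by rewrite nB (leq_ltn_trans _ nB)//; have /and3P[] := nk.
by rewrite (perm_big _ per)/= big_map.
Qed.

Local Notation A := (sector_area Phi).
Local Notation K' := (phi_max Phi K + K).

(** Each d <= B costs O(r / d + 1); summing gives the harmonic factor and the extra B. *)
Lemma primitive_count_asymptotic : exists2 C : R, 0 <= C &
  forall (r : R) (B : nat), 0 <= r -> r + K' < c * B%:R ->
  `|primitive_count r B - 6 / pi ^+ 2 * A * r ^+ 2| <=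
    C * (r * (1 + ln B%:R) + B%:R).
Proof.
have [C C0 hC] := lattice_count_asymptotic c0 K0 Phi_ge Phi_lip.
have A0 := sector_area_ge0 Phi.
have K'0 := cell_osc_gt0 c0 K0 Phi_ge Phi_lip.
set kap : R := 6 / pi ^+ 2.
have k0 : 0 < kap by rewrite divr_gt0// exprn_gt0// pi_gt0.
have kE : kap * (pi ^+ 2 / 6) = 1.
  by rewrite /kap mulrA divfK ?divff// expf_neq0// lt0r_neq0// pi_gt0.
(* C is the lattice count error at radius r / d. The rest pays for cutting the Basel sum at J =
   [B %/ d]: since r < c B and B <= 2 d J, one has (r / d)^2 / J <= 2 c r / d. *)
pose C2 := C + A * kap * 2 * c.
have Ak0 := mulr_ge0 A0 (ltW k0).
have C20 : 0 <= C2.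
  exact: addr_ge0 C0 (mulr_ge0 (mulr_ge0 Ak0 (ler0n _ 2)) (ltW c0)).
exists C2 => // r B r0 rB.
have rB' : r < c * B%:R by lra.
have B0 : (0 < B)%N.
  by case: B rB' {rB} => //; rewrite mulr0 ltNge r0.
(* Inverting the error term itself, rather than the lattice count, makes only
   partial sums of 1 / j ^ 2 appear instead of the series of mu(d) / d ^ 2. *)
pose e (n : nat) : R := primitive_count (r / n%:R) B - kap * A * (r / n%:R) ^+ 2.
have -> : primitive_count r B - kap * A * r ^+ 2 = e 1%N by rewrite /e divr1.
rewrite -(mobius_inversion e B0).
apply: le_trans (ler_norm_sum _ _ _) _.
apply: le_trans (_ : \sum_(1 <= d < B.+1) C2 * (r / d%:R + 1) <= _); last first.
  rewrite -mulr_sumr ler_wpM2l// big_split/= -mulr_sumr.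
  rewrite sumr_const_nat subSS subn0 lerD2r ler_wpM2l//.
  exact: harmonic_le.
rewrite big_nat [leRHS]big_nat; apply: ler_sum => d /andP[d0 dB].
rewrite normrM; apply: le_trans (ler_wpM2r (normr_ge0 _) (mobius_norm_le1 d)) _.
rewrite mul1r.
have dR : 0 < d%:R :> R by rewrite ltr0n.
have d1 : 1 <= d%:R :> R by rewrite ler1n.
have J0 : (0 < B %/ d)%N by rewrite divn_gt0.
have rd : r / d%:R <= r by rewrite ler_pdivrMr// ler_peMr.
have rd0 : 0 <= r / d%:R by rewrite divr_ge0// ltW.
have -> : \sum_(1 <= j < (B %/ d).+1) e (d * j)%N =
    lattice_count Phi (r / d%:R) B -
    kap * A * (r / d%:R) ^+ 2 * inv_sqr_sum (B %/ d).
  rewrite (@count_by_gcd _ B (B %/ d)).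
  - rewrite /inv_sqr_sum mulr_sumr -sumrB big_nat [RHS]big_nat.
    apply: eq_bigr => j /andP[j0 _]; rewrite /e natrM.
    have jR : 0 < j%:R :> R by rewrite ltr0n.
    have -> : r / (d%:R * j%:R) = r / d%:R / j%:R by rewrite invfM mulrA.
    by rewrite expr_div_n mulrA.
  - by apply: le_lt_trans rB'.
  - rewrite ltr_pdivrMr// (lt_le_trans rB')// -mulrA ler_wpM2l ?(ltW c0)//.
    by rewrite -natrM ler_nat ltnW// ltn_ceil.
have bas := @basel R _ J0.
have h1 : `|lattice_count Phi (r / d%:R) B - A * (r / d%:R) ^+ 2| <= C * (r / d%:R + 1).
  by apply: hC => //; lra.
have h2 : `|A * (r / d%:R) ^+ 2 - kap * A * (r / d%:R) ^+ 2 * inv_sqr_sum (B %/ d)|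
    <= A * kap * 2 * c * (r / d%:R).
  have -> : A * (r / d%:R) ^+ 2 - kap * A * (r / d%:R) ^+ 2 * inv_sqr_sum (B %/ d) =
      A * kap * (r / d%:R) ^+ 2 * (pi ^+ 2 / 6 - inv_sqr_sum (B %/ d)).
    transitivity (A * (r / d%:R) ^+ 2 * (kap * (pi ^+ 2 / 6)) -
      kap * A * (r / d%:R) ^+ 2 * inv_sqr_sum (B %/ d)); first by rewrite kE mulr1.
    move: (pi ^+ 2 / 6) (inv_sqr_sum _) => p S; ring.
  case/andP: bas => b0 b1.
  have q0 : 0 <= A * kap * (r / d%:R) ^+ 2 by rewrite mulr_ge0 ?sqr_ge0.
  rewrite ger0_norm; last exact: mulr_ge0.
  apply: le_trans (ler_wpM2l q0 b1) _.
  have JR : 0 < (B %/ d)%:R :> R by rewrite ltr0n.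
  have BJ : r <= 2 * c * ((B %/ d)%:R * d%:R).
    apply: le_trans (ltW rB') _; rewrite [2 * c]mulrC -mulrA ler_wpM2l ?(ltW c0)//.
    rewrite -!natrM ler_nat.
    have := leq_pmull d J0; have := ltn_ceil B d0; rewrite mulSn; clear.
    by move: (B %/ d * d)%N => w; lia.
  have h : (r / d%:R) ^+ 2 / (B %/ d)%:R <= 2 * c * (r / d%:R).
    rewrite expr2 -mulrA mulrC ler_wpM2r// ler_pdivrMr// ler_pdivrMr//.
    by rewrite -mulrA.
  have := ler_wpM2l Ak0 h; rewrite !mulrA; exact.
have -> : lattice_count Phi (r / d%:R) B - kap * A * (r / d%:R) ^+ 2 * inv_sqr_sum (B %/ d) =
  (lattice_count Phi (r / d%:R) B - A * (r / d%:R) ^+ 2) +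
  (A * (r / d%:R) ^+ 2 - kap * A * (r / d%:R) ^+ 2 * inv_sqr_sum (B %/ d)) by ring.
apply: le_trans (ler_normD _ _) _; apply: le_trans (lerD h1 h2) _.
have := mulr_ge0 (mulr_ge0 A0 (ltW k0)) (ltW c0); rewrite /C2; lra.
Qed.

End PrimitivePoints.

(** * The wedge and the label count *)

Section WedgeSector.
Context {R : realType} (T : markov_tree R).
Hypothesis hT : rising T.
Local Notation Phi := (encoding T).

(** With x = r cos theta and y / x = tan theta, the polar bound reads x Phi(y / x) <= 1. The origin
    has no slope and is treated apart. *)
Lemma wedge_sector : wedge T = sector Phi 1.
Proof.
have [c [K [c0 _ hc _ _]]] := encoding_spec hT.
have p0 := pi_gt0 R.
apply/seteqP; split => [z [th [r [/andP[t0 t4] /andP[r0 rf] ->]]]|[x y] [/= /andP[y0 yx] h]].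
  have cth : 0 < cos th by apply: cos_gt0_pihalf; apply/andP; split; lra.
  have tan1 : tan th <= 1.
    rewrite leNgt; apply/negP => /lt_atan; rewrite atan1 tanK; first by rewrite ltNge t4.
    by rewrite in_itv/=; apply/andP; split; lra.
  have sth : 0 <= sin th by apply: sin_ge0_pi; rewrite t0/=; lra.
  have tanE : tan th = sin th / cos th by [].
  have tan0 : 0 <= tan th by rewrite tanE divr_ge0// ltW.
  have sc : sin th <= cos th by move: tan1; rewrite tanE ler_pdivrMr// mul1r.
  split; first by rewrite /= mulr_ge0//= ler_wpM2l.
  rewrite /radial/=; move: r0 rf; rewrite le_eqVlt => /predU1P[<- _|r0 rf].
    by rewrite !mul0r.
  have -> : r * sin th / (r * cos th) = tan th.
    by rewrite tanE; field; rewrite !lt0r_neq0.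
  have P0 : 0 < Phi (tan th) by apply: lt_le_trans c0 (hc _ _); rewrite tan0.
  by move: rf; rewrite -[(_ * _)^-1]mul1r ler_pdivlMr ?mulr_gt0// mulrA.
have x0 := le_trans y0 yx.
move: x0; rewrite le_eqVlt => /predU1P[ex|x0].
  have ey : y = 0 by apply/le_anti; rewrite y0 ex yx.
  exists 0, 0; rewrite !mul0r -ex ey; split => //.
    by rewrite lexx divr_ge0// ltW.
  rewrite lexx invr_ge0 cos0 mul1r tan0.
  by rewrite (le_trans (ltW c0))// hc// lexx ler01.
have c1 : 0 < cos (atan (y / x)).
  by apply: cos_gt0_pihalf; rewrite atan_gtNpi2 atan_ltpi2.
have yx0 : 0 <= y / x by rewrite divr_ge0// ltW.
have yx1 : y / x <= 1 by rewrite ler_pdivrMr// mul1r.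
exists (atan (y / x)), (x / cos (atan (y / x))); split.
- rewrite -atan0 -[X in _ && (_ <= X)]atan1.
  by apply/andP; split; apply: le_atan.
- rewrite divr_ge0 ?(ltW x0) ?(ltW c1)//= atanK.
  rewrite invfM mulrC ler_pM2l ?invr_gt0//.
  have P0 : 0 < Phi (y / x) by apply: lt_le_trans c0 (hc _ _); rewrite yx0.
  by rewrite -[X in _ <= X]mul1r ler_pdivlMr.
- rewrite divfK ?lt0r_neq0//; congr (_, _).
  rewrite mulrAC -mulrA -[sin _ / cos _]/(tan (atan (y / x))) atanK.
  by rewrite mulrC divfK// lt0r_neq0.
Qed.

Lemma area_wedge : area (wedge T) = sector_area Phi.
Proof. by rewrite /area wedge_sector. Qed.

(** Lowest terms identify rationals with primitive points, and monotonicity of [cosh] turns the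
    label bound into a radial one. The set is thereby finite, so [fset_set] is faithful. *)
Lemma label_count_primitive (c X : R) (B : nat) : 0 < c ->
  (forall x : R, 0 <= x <= 1 -> c <= Phi x) ->
  2 <= X -> arcosh_half X < c * B%:R ->
  (label_count T X)%:R = primitive_count Phi (arcosh_half X) B.
Proof.
move=> c0 hc X2 rB; set r := arcosh_half X in rB *.
have [_ [_ [_ _ _ _ hq]]] := encoding_spec hT.
have [r0 rX _ _] := arcosh_halfP X2; rewrite -/r in r0 rX.
pose g (p : nat * nat) : rat := (p.2%:Z)%:Q / (p.1%:Z)%:Q.
pose s := [seq p <- grid B | coprime p.1 p.2 && lattice_point Phi r p.1 p.2].
have gE p : (0 < p.1)%N -> coprime p.1 p.2 -> denq (g p) = p.1%:Z /\ numq (g p) = p.2%:Z.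
  move=> p10 cop; have cop' : coprime `|p.2%:Z| `|p.1%:Z| by rewrite !absz_nat coprime_sym.
  rewrite /g coprimeq_den// coprimeq_num//; split; last by rewrite gtr0_sg ?mul1r.
  by case: eqP => // e; move: p10; case: (p.1) e.
have ratrg (q : rat) : ratr q = (numq q)%:~R / (denq q)%:~R :> R by [].
have key (q : rat) : 0 <= q <= 1 ->
    (T q <= X) = ((denq q)%:~R * Phi (ratr q) <= r).
  move=> q01; rewrite hq// -rX ler_pM2l// ler_cosh//.
  have d0 : 0 <= (denq q)%:~R :> R by rewrite ler0z ltW// denq_gt0.
  by rewrite mulr_ge0// (le_trans (ltW c0))// hc// ratr_in01.
have setE : [set q : rat | 0 <= q <= 1 /\ T q <= X] =
    [set` [fset x | x in map g s]%fset].
  apply/seteqP; split => q /=.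
    move=> [q01 qX]; rewrite inE; apply/mapP.
    have d0 := denq_gt0 q; have /andP[q0 q1] := q01.
    have n0 : 0 <= numq q by rewrite numq_ge0.
    have ed : (`|denq q|%N)%:Z = denq q by rewrite gez0_abs// ltW.
    have en : (`|numq q|%N)%:Z = numq q by rewrite gez0_abs.
    exists (`|denq q|%N, `|numq q|%N); last by rewrite /g /= ed en divq_num_den.
    have lpq : lattice_point Phi r `|denq q| `|numq q|.
      apply/and3P; split; first by lia.
        by move: q1; rewrite leq_cross mulr1 mul1r; lia.
      by rewrite /radial/= !pmulrn ed en -ratrg -key.
    have dB : (`|denq q| < B)%N.
      rewrite -(ltr_nat R) -(ltr_pM2l c0).
      exact: le_lt_trans (lattice_point_le hc lpq) rB.
    rewrite mem_filter mem_grid/= lpq dB.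
    have /and3P[_ nd _] := lpq; rewrite (leq_ltn_trans nd dB) !andbT.
    by rewrite coprime_sym coprime_num_den.
  rewrite inE => /mapP[[n k]]; rewrite mem_filter mem_grid/= => /andP[/andP[cop nk] _] ->.
  have /and3P[n0 kn rad] := nk.
  have [dg ng] := gE (n, k) n0 cop.
  have g01 : 0 <= g (n, k) <= 1.
    rewrite -numq_ge0 ng/= leq_cross ng dg mulr1 mul1r/=.
    by rewrite lez_nat.
  by split => //; rewrite key// ratrg dg ng.
rewrite /label_count setE set_fsetK card_fseq undup_id; last first.
  rewrite map_inj_in_uniq ?filter_uniq ?grid_uniq// => -[n k] [n' k'].
  rewrite !mem_filter/= => /andP[/andP[cop /and3P[n0 _ _]] _].
  move=> /andP[/andP[cop' /and3P[n0' _ _]] _] e.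
  have [d1 e1] := gE (n, k) n0 cop; have [d2 e2] := gE (n', k') n0' cop'.
  by move: d1 e1; rewrite e d2 e2 /= => -[->] [->].
rewrite size_map size_filter /primitive_count -sum1_count natr_sum big_mkcond/=.
by apply: eq_bigr => p _; case: ifP.
Qed.

End WedgeSector.

Theorem theorem6p3 (R : realType) (T : markov_tree R) (hT : rising T) :
  (fun X : R => (label_count T X)%:R : R) =
    (fun X : R => 6 * area (wedge T) / pi ^+ 2 * ln X ^+ 2)
    +O_ (pinfty_nbhs R) (fun X : R => ln X * ln (ln X)).
Proof.
have [c [K [c0 K0 hc hK _]]] := encoding_spec hT.
have [C C0 hC] := primitive_count_asymptotic c0 K0 hc hK.
rewrite (area_wedge hT).
set A := sector_area (encoding T) in hC *.
have A0 : 0 <= A by exact: sector_area_ge0.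
set K' := phi_max (encoding T) K + K in hC.
have K'0 : 0 < K' := cell_osc_gt0 c0 K0 hc hK.
pose kap : R := 6 / pi ^+ 2 * A.
have kap0 : 0 <= kap by rewrite mulr_ge0// divr_ge0// sqr_ge0.
(* Chosen so that the box size B below is at most w times ln X. *)
pose w := (1 + K') / c + 1.
have w1 : 1 <= w by rewrite lerDr divr_ge0 ?ltW//; lra.
apply/eqaddOP; near=> k; near=> X.
(* With L = ln X this threshold yields ln L >= 1, so terms of order L are absorbed in L ln L, and L
   >= w, so ln B <= 2 ln L. *)
have XM : expR (expR 1 + w) <= X by near: X; exact: nbhs_pinfty_ge.
have e1 : 2 <= expR 1 :> R by have := expR_ge1Dx (1 : R); lra.
have X0 : 0 < X by apply: lt_le_trans XM; exact: expR_gt0.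
set L := ln X.
have LM : expR 1 + w <= L by rewrite /L -[leLHS]expRK ler_ln ?posrE ?expR_gt0.
have L0 : 0 < L by lra.
have lL1 : 1 <= ln L by rewrite -[leLHS]expRK ler_ln ?posrE ?expR_gt0//; lra.
have X2 : 2 <= X by have := expR_ge1Dx (expR 1 + w); lra.
have [r0 _ rlo rhi] := arcosh_halfP X2; set r := arcosh_half X in r0 rlo rhi.
rewrite -/L in rhi.
have rL : L - 1 <= r.
  apply: le_trans rlo; rewrite ln_div ?posrE// lerD2l lerN2.
  by rewrite -[leRHS]expRK ler_ln ?posrE ?expR_gt0.
pose B := (Num.truncn ((r + K') / c)).+1.
have q0 : 0 <= (r + K') / c by rewrite divr_ge0 ?ltW//; lra.
have /andP[B1 B2] := truncn_itv q0.
have rB : r + K' < c * B%:R by rewrite mulrC -ltr_pdivrMr.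
have rB' : r < c * B%:R by lra.
change (`|(label_count T X)%:R - 6 * A / pi ^+ 2 * L ^+ 2| <= k * `|L * ln L|).
rewrite (label_count_primitive hT c0 hc X2 rB') -/r.
have BL : B%:R <= w * L.
  rewrite /B -natr1; apply: le_trans (_ : (L + K') / c + 1 <= _).
    by rewrite lerD2r (le_trans B1)// ler_pM2r ?invr_gt0// lerD2r.
  have -> : w * L = (L + K' * L) / c + L by rewrite /w; field; rewrite lt0r_neq0.
  apply: lerD; last by lra.
  rewrite ler_pM2r ?invr_gt0// lerD2l.
  by rewrite ler_peMr ?(ltW K'0)//; lra.
have B0 : 0 < B%:R :> R by rewrite ltr0n.
have lB : ln B%:R <= 2 * ln L.
  apply: le_trans (_ : ln (w * L) <= _).
    by rewrite ler_ln ?posrE// mulr_gt0//; lra.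
  rewrite lnM ?posrE//; last by lra.
  by rewrite mulr_natl mulr2n lerD2r ler_ln ?posrE//; lra.
have main := hC r B r0 rB.
have e0 : 0 <= L * ln L by rewrite mulr_ge0//; lra.
rewrite (ger0_norm e0).
have -> : primitive_count (encoding T) r B - 6 * A / pi ^+ 2 * L ^+ 2 =
   (primitive_count (encoding T) r B - 6 / pi ^+ 2 * A * r ^+ 2) + kap * (r ^+ 2 - L ^+ 2).
  by rewrite /kap; ring.
apply: le_trans (ler_normD _ _) _; apply: le_trans (lerD main (lexx _)) _.
(* From L - 1 <= r <= L the squares differ by at most 2 L. *)
have h2 : `|kap * (r ^+ 2 - L ^+ 2)| <= 2 * kap * (L * ln L).
  rewrite normrM ger0_norm// distrC ger0_norm; last by nra.
  have -> : 2 * kap * (L * ln L) = kap * (2 * (L * ln L)) by ring.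
  rewrite (ler_wpM2l kap0)//.
  apply: le_trans (_ : 2 * L <= _); first by nra.
  by rewrite ler_pM2l// ler_peMr// (ltW L0).
(* The 3 comes from 1 + ln B <= 3 ln L, and w from B <= w L. *)
have h1 : C * (r * (1 + ln B%:R) + B%:R) <= C * ((3 + w) * (L * ln L)).
  rewrite ler_wpM2l// mulrDl; apply: lerD.
    rewrite mulrCA; apply: le_trans (_ : L * (1 + ln B%:R) <= _).
      by rewrite ler_wpM2r ?addr_ge0 ?ln_ge0 ?ler1n.
    by rewrite ler_pM2l//; lra.
  by apply: le_trans BL _; rewrite ler_pM2l ?ler_peMr ?(ltW L0)//; lra.
apply: le_trans (lerD h1 h2) _.
have -> : C * ((3 + w) * (L * ln L)) + 2 * kap * (L * ln L) =
  (C * (3 + w) + 2 * kap) * (L * ln L) by ring.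
by rewrite ler_wpM2r//; near: k; exact: nbhs_pinfty_ge.
Unshelve. all: by end_near. Qed.
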